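(* For every integer $d\ge 1$, the value $\Delta_d^{LP}$ of the Cohn--Elkies linear program in dimension $d$ satisfies $$\Delta_d^{LP}\ \ge\ \frac14\left(\frac{e}{8}\right)^{\frac d2}.$$
   Context: The Fourier transform on $\mathbb{R}^d$ is normalised by $\widehat{f}(\omega)=\int_{\mathbb{R}^d} f(x)e^{-2\pi i\langle x,\omega\rangle}\,dx$. Let $|B_1|$ denote the volume of the unit ball in $\mathbb{R}^d$, and let $e$ be Euler's number. The quantity $\Delta_d^{LP}$ is defined as the infimum of $|B_1|\left(\frac r2\right)^d$ over all pairs $(f,r)$, where $r>0$ and $f\colon\mathbb{R}^d\to\mathbb{R}$ is a continuous, integrable function satisfying: (i) $f(0)=\widehat f(0)>0$; (ii) $f(x)\le 0$ for all $|x|\ge r$; (iii) $\widehat f(t)\ge 0$ for all $t\in\mathbb{R}^d$ (in particular $\widehat f$ is real-valued). *)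

(* Defs.v *)
From HB Require Import structures.
From mathcomp Require Import all_boot all_order all_algebra.
From mathcomp Require Import all_classical all_reals all_analysis.
From mathcomp Require Import complex.

Set Implicit Arguments.
Unset Strict Implicit.
Unset Printing Implicit Defensive.

Import Order.TTheory GRing.Theory Num.Theory.
Import numFieldNormedType.Exports.

Local Open Scope classical_set_scope.
Local Open Scope ring_scope.
Local Open Scope complex_scope.

Definition rV_display : measure_display -> measure_display.
Proof. exact. Qed.

Section measurable_rV.
Variables (R : realType) (n : nat).

Let coord (i : 'I_n) (x : 'rV[R]_n) : measurableTypeR R := x ord0 i.

Let rV_set0 : g_sigma_preimage coord set0.
Proof. exact: sigma_algebra0. Qed.

Let rV_setC A : g_sigma_preimage coord A -> g_sigma_preimage coord (~` A).
Proof. exact: sigma_algebraC. Qed.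

Let rV_bigcup (F : _^nat) : (forall i, g_sigma_preimage coord (F i)) ->
  g_sigma_preimage coord (\bigcup_i (F i)).
Proof. exact: sigma_algebra_bigcup. Qed.

(* The product sigma-algebra on R^n, generated by the coordinate maps. *)
HB.instance Definition _ := @isMeasurable.Build
  (rV_display R.-ocitv.-measurable.-sigma) 'rV[R]_n
  (g_sigma_preimage coord) rV_set0 rV_setC rV_bigcup.

End measurable_rV.

Definition rV_cons (R : realType) (n : nat)
    (p : measurableTypeR R * 'rV[R]_n) : 'rV[R]_n.+1 :=
  row_mx (const_mx p.1 : 'rV[R]_1) p.2.

Lemma rV_cons0 (R : realType) n (p : measurableTypeR R * 'rV[R]_n) :
  rV_cons p ord0 ord0 = p.1.
Proof.
transitivity (row_mx (const_mx p.1 : 'rV[R]_1) p.2 ord0 (lshift n ord0)).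
  by congr (row_mx _ _ _ _); exact/val_inj.
by rewrite row_mxEl mxE.
Qed.

Lemma rV_consS (R : realType) n (p : measurableTypeR R * 'rV[R]_n) (i : 'I_n) :
  rV_cons p ord0 (lift ord0 i) = p.2 ord0 i.
Proof.
transitivity (row_mx (const_mx p.1 : 'rV[R]_1) p.2 ord0 (rshift 1 i)).
  by congr (row_mx _ _ _ _); exact/val_inj.
by rewrite row_mxEr.
Qed.

Lemma measurable_coord (R : realType) n (i : 'I_n) :
  measurable_fun setT (fun x : 'rV[R]_n => x ord0 i : measurableTypeR R).
Proof.
move=> _ Y mY; rewrite setTI; apply: sub_sigma_algebra => /=.
rewrite -bigcup_seq/=; exists i => /=; first by rewrite mem_index_enum.
by exists Y => //; rewrite setTI.
Qed.

Lemma measurable_fun_rV d (T : measurableType d) (R : realType) n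
    (f : T -> 'rV[R]_n) :
  (forall i, measurable_fun setT (fun t => f t ord0 i : measurableTypeR R)) ->
  measurable_fun setT f.
Proof.
move=> mf _ A mA; rewrite setTI.
move: A mA; apply: smallest_sub => /=.
  split.
  - by rewrite preimage_set0.
  - move=> A mA; rewrite setTD -preimage_setC; exact: measurableC.
  - move=> F mF; rewrite preimage_bigcup; exact: bigcupT_measurable.
rewrite -bigcup_seq/= => A [i _ [B mB <-]].
by have := mf i measurableT B mB; rewrite !setTI.
Qed.

Lemma measurable_rV_cons (R : realType) n : measurable_fun setT (@rV_cons R n).
Proof.
apply: measurable_fun_rV => i; have [j ->|->] := unliftP ord0 i.
  apply: (eq_measurable_fun
    ((fun x : 'rV[R]_n => x ord0 j : measurableTypeR R) \o snd)).
    by move=> p _; rewrite /= rV_consS.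
  by apply: measurableT_comp => //; exact: measurable_coord.
apply: (eq_measurable_fun fst) => // p _; by rewrite /= rV_cons0.
Qed.

Definition rV_uncons (R : realType) (n : nat) (x : 'rV[R]_n.+1) :
    measurableTypeR R * 'rV[R]_n :=
  (x ord0 ord0, \row_i x ord0 (lift ord0 i)).

Lemma rV_consK (R : realType) n : cancel (@rV_cons R n) (@rV_uncons R n).
Proof.
move=> p; rewrite /rV_uncons rV_cons0 [RHS]surjective_pairing; congr pair.
by apply/rowP => i; rewrite mxE rV_consS.
Qed.

Lemma measurable_rV_uncons (R : realType) n :
  measurable_fun setT (@rV_uncons R n).
Proof.
apply: measurable_fun_pair; first exact: measurable_coord.
apply: measurable_fun_rV => i; under eq_fun do rewrite mxE.
exact: measurable_coord.
Qed.

Section lebesgue_rV_step.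
Local Open Scope ereal_scope.
Variables (R : realType) (n : nat).
Variable mu : {sigma_finite_measure set 'rV[R]_n -> \bar R}.

Definition lebesgue_rV_step : set 'rV[R]_n.+1 -> \bar R :=
  pushforward (@lebesgue_measure R \x mu) (@rV_cons R n).

Let step0 : lebesgue_rV_step set0 = 0.
Proof. by rewrite /lebesgue_rV_step /pushforward preimage_set0 measure0. Qed.

Let step_ge0 A : 0 <= lebesgue_rV_step A.
Proof. exact: (measure_ge0 (@lebesgue_measure R \x mu)). Qed.

Let step_sigma_additive : semi_sigma_additive lebesgue_rV_step.
Proof.
move=> F mF tF mUF; rewrite /lebesgue_rV_step /pushforward preimage_bigcup.
have mcons A : measurable A -> measurable (@rV_cons R n @^-1` A).
  by move=> mA; rewrite -[X in measurable X]setTI; exact: measurable_rV_cons.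
apply: measure_semi_sigma_additive.
- by move=> k; exact: mcons.
- apply/trivIsetP => /= i j _ _ ij; rewrite -preimage_setI.
  by move/trivIsetP : tF => /(_ _ _ _ _ ij) ->//; rewrite preimage_set0.
- by rewrite -preimage_bigcup; exact: mcons.
Qed.

HB.instance Definition _ := isMeasure.Build _ _ _ lebesgue_rV_step
  step0 step_ge0 step_sigma_additive.

Let step_sigma_finite : sigma_finite setT lebesgue_rV_step.
Proof.
have /sigma_finiteP[F [FT ndF Foo]] := sigma_finiteT (@lebesgue_measure R).
have /sigma_finiteP[G [GT ndG Goo]] := sigma_finiteT mu.
exists (fun k => @rV_uncons R n @^-1` (F k `*` G k)).
  apply/esym; rewrite -subTset => x _.
  have [i _ Fi] : (\bigcup_k F k) (rV_uncons x).1 by rewrite -FT.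
  have [j _ Gj] : (\bigcup_k G k) (rV_uncons x).2 by rewrite -GT.
  exists (maxn i j) => //; split.
    by move: Fi; exact/subsetPset/ndF/leq_maxl.
  by move: Gj; exact/subsetPset/ndG/leq_maxr.
move=> k; have [mF Fkoo] := Foo k; have [mG Gkoo] := Goo k; split.
  rewrite -[X in measurable X]setTI.
  by apply: measurable_rV_uncons => //; exact: measurableX.
rewrite /lebesgue_rV_step /pushforward -comp_preimage.
rewrite (_ : _ \o _ = id); last by apply/funext => p /=; rewrite rV_consK.
by rewrite preimage_id product_measure1E// lte_mul_pinfty// ge0_fin_numE.
Qed.

HB.instance Definition _ := Measure_isSigmaFinite.Build _ _ _
  lebesgue_rV_step step_sigma_finite.

End lebesgue_rV_step.

(* Lebesgue measure on R^n: the image of the n-fold product of the Lebesgue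
   measure on R, with the unit mass on the one-point space R^0. *)
Fixpoint lebesgue_rV (R : realType) (n : nat) :
    {sigma_finite_measure set 'rV[R]_n -> \bar R} :=
  match n with
  | 0 => dirac (0 : 'rV[R]_0)
  | n'.+1 => lebesgue_rV_step (lebesgue_rV R n')
  end.

(* The box formula, which characterises Lebesgue measure. *)
Lemma lebesgue_rV_box (R : realType) (n : nat)
    (A : 'I_n -> set (measurableTypeR R)) :
  (forall i, measurable (A i)) ->
  lebesgue_rV R n [set x | forall i, A i (x ord0 i)] =
  (\prod_(i < n) lebesgue_measure (A i))%E.
Proof.
elim: n A => [|n IH] A mA.
  rewrite big_ord0 /= diracE mem_set//.
  by move=> [].
rewrite big_ord_recl -IH//= /lebesgue_rV_step /pushforward.
have mA' : measurable
    [set x : 'rV[R]_n | forall i, A (lift ord0 i) (x ord0 i)].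
  rewrite (_ : mkset _ = \bigcap_(i in setT)
    ((fun x : 'rV[R]_n => x ord0 i : measurableTypeR R) @^-1` A (lift ord0 i))).
    apply: fin_bigcap_measurable; first exact: finite_finset.
    move=> i _; rewrite -[X in measurable X]setTI.
    by apply: measurable_coord => //; exact: mA.
  by apply/seteqP; split=> [x Ax i _|x Ax i]; [exact: Ax|exact: (Ax i I)].
rewrite -product_measure1E//.
congr (_ _); apply/seteqP; split=> p /=.
  move=> Ap; split; first by rewrite -rV_cons0; exact: Ap.
  by move=> i; rewrite -rV_consS; exact: Ap.
move=> [A0 AS] i; have [j ->|->] := unliftP ord0 i; last by rewrite rV_cons0.
by rewrite rV_consS; exact: AS.
Qed.

Section cohn_elkies.
Variables (R : realType) (d : nat).
Implicit Types (x y t : 'rV[R]_d) (f : 'rV[R]_d -> R) (r : R).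

Definition dotp x y : R := \sum_(i < d) x ord0 i * y ord0 i.

(* The library norm on 'rV[R]_d is the sup norm; the Euclidean norm is needed. *)
Definition norm2 x : R := Num.sqrt (dotp x x).

Definition expi (a : R) : R[i] := cos a +i* sin a.

Definition Cintegral (F : 'rV[R]_d -> R[i]) : R[i] :=
  (\int[lebesgue_rV R d]_x complex.Re (F x)) +i*
  (\int[lebesgue_rV R d]_x complex.Im (F x)).

Definition fourier f t : R[i] :=
  Cintegral (fun x => (f x)%:C * expi (- (2 * pi * dotp x t))).

Definition vol_unit_ball : \bar R :=
  lebesgue_rV R d [set x | norm2 x <= 1].

(* In R[i], 0 <= z means that z is real and nonnegative. *)
Definition LP_feasible f r : Prop :=
  [/\ 0 < r,
      continuous f,
      (lebesgue_rV R d).-integrable setT (EFin \o f),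
      (f 0)%:C = fourier f 0 /\ 0 < f 0 &
      (forall x, r <= norm2 x -> f x <= 0) /\
      (forall t, 0 <= fourier f t)].

Definition Delta_LP : \bar R :=
  ereal_inf [set (vol_unit_ball * ((r / 2) ^+ d)%:E)%E
            | r in [set r | exists f, LP_feasible f r]].

End cohn_elkies.

(* Main.v *)
From HB Require Import structures.
Require Import Defs.
From mathcomp Require Import all_boot all_order all_algebra.
From mathcomp Require Import all_classical all_reals all_analysis.
From mathcomp Require Import measurable_realfun complex ring lra.

(** Feasible functions are tested against centred balls only. Let f be feasible
    with radius r, and let G s be the integral of f over the ball of radius s.
    As f is nonpositive outside the ball of radius r,
    f(0) = \int f <= G s <= G r for all s >= r. If the Fourier transform of
    a 1_{B_r} - b 1_{B_s} is bounded above by M, then integrating it against the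
    transform of f, which is nonnegative, gives a G r - b G s <= M f(0)
    ([ball_duality]). The choice a = 1, b = 0 gives |B_1| r^d >= 1, which implies
    the claim for d <= 7.

    For d >= 8 put nu = d / 2 and T = (2 / e)^nu, and take a = r^(-nu),
    b = s^(-nu) with s decreasing to r. Let v and u be the transforms of the unit
    ball and of the unit sphere, as functions of k = 2 pi |t|, normalised to 1 at
    the origin. The transform of the dual function is
    |B_1| k^(-nu) ((r k)^nu v(r k) - (s k)^nu v(s k)), so it is at most
    4 T |B_1| (s^nu - r^nu) as soon as x^nu (v + 4 T) is nondecreasing in x,
    which is the inequality v - 2 u <= 4 T ([wave_gap_le]). In the limit s = r,
    duality becomes 1 <= 4 T |B_1| r^d ([radius_bound_sharp]), and this is the
    claim because (e / 8)^nu (2 / e)^nu 2^d = 1.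

    The inequality v - 2 u <= 4 T ([pair_phi_bound]) combines the system
    u' = - (k / d) v, v' = (d / k) (u - v) with an energy bound. As long as u is
    nonnegative, v is nonnegative and decreasing; then Plancherel's theorem for
    the unit ball, restricted to frequencies of norm less than k / (2 pi), gives
    v(k)^2 k^d <= (2 pi)^d / |B_1|^2 ([ball_transform_decay]). The right-hand side
    is at most 8 d nu^d T^2 by a lower bound of Stirling type for |B_1|
    ([ball_coef_lower]), so v is so small for k > nu that the equation for
    v - 2 u keeps it below 2 T up to the first zero of u. Beyond this zero,
    u^2 + (k / d)^2 v^2 decreases and dominates (v - 2 u)^2 up to a factor. *)

Set Implicit Arguments.
Unset Strict Implicit.
Unset Printing Implicit Defensive.

Import Order.TTheory GRing.Theory Num.Theory.
Import numFieldNormedType.Exports.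

Local Open Scope classical_set_scope.
Local Open Scope ring_scope.

(** * Changes of variables for Lebesgue measure *)

Section lebesgue_affine.
Variable R : realType.
Local Notation mu := (@lebesgue_measure R).

Lemma measurable_fun_affine (a b : R) :
  measurable_fun setT (fun x : measurableTypeR R => b + a * x : measurableTypeR R).
Proof.
by apply: measurable_funD => //; exact: mulrl_measurable.
Qed.

(** The right-hand side defines a measure that agrees with Lebesgue measure on
    intervals, hence everywhere by uniqueness. *)
Lemma lebesgue_measure_affine (a b : R) (A : set R) : 0 < a -> measurable A ->
  mu A = (a%:E * mu ((fun x => b + a * x)%R @^-1` A))%E.
Proof.
move=> a0 mA.
pose phi : measurableTypeR R -> measurableTypeR R := fun x => b + a * x.
have mphi : measurable_fun setT phi by exact: measurable_fun_affine.
have a0' : 0 <= a by exact: ltW.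
pose P : {measure set (measurableTypeR R) -> \bar R} :=
  measure_function_pushforward__canonical__measure_function_Measure mu mphi.
pose nu : {measure set (measurableTypeR R) -> \bar R} := mscale (NngNum a0') P.
have := @lebesgue_measure_unique R nu _ A mA.
rewrite /nu /mscale /= /pushforward; apply => //.
move=> _ [[x y]] _ <- /=; rewrite /mscale /= /pushforward.
have -> : phi @^-1` `]x, y] = `]((x - b) / a), ((y - b) / a)]%classic.
  apply/seteqP; split => z /=; rewrite !in_itv/= /phi.
    by rewrite ltr_pdivrMr// ler_pdivlMr// ltrBlDl lerBrDl mulrC.
  by rewrite ltr_pdivrMr// ler_pdivlMr// ltrBlDl lerBrDl mulrC.
rewrite !lebesgue_measure_itv/= !lte_fin.
rewrite ltr_pM2r ?invr_gt0// ltrD2r.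
case: ifPn => _; last by rewrite mule0.
by rewrite -!EFinB -EFinM; congr EFin; field; rewrite gt_eqF.
Qed.

Lemma ge0_integral_affine (a b : R) (F : R -> \bar R) : 0 < a ->
  measurable_fun setT F -> (forall x, 0 <= F x)%E ->
  (\int[mu]_x F x = a%:E * \int[mu]_x F (b + a * x)%R)%E.
Proof.
move=> a0 mF F0.
pose phi : measurableTypeR R -> measurableTypeR R := fun x => b + a * x.
have mphi : measurable_fun setT phi by exact: measurable_fun_affine.
have a0' : 0 <= a by exact: ltW.
pose P : {measure set (measurableTypeR R) -> \bar R} :=
  measure_function_pushforward__canonical__measure_function_Measure mu mphi.
have -> : (\int[mu]_x F x = \int[mscale (NngNum a0') P]_x F x)%E.
  by apply: eq_measure_integral => A mA _; exact: lebesgue_measure_affine.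
rewrite ge0_integral_mscale//; congr (_ * _)%E.
by rewrite ge0_integral_pushforward// preimage_setT.
Qed.

Lemma ge0_integral_oppr (F : R -> \bar R) :
  measurable_fun setT F -> (forall x, 0 <= F x)%E ->
  (\int[mu]_x F x = \int[mu]_x F (- x)%R)%E.
Proof.
move=> mF F0.
have -> : (\int[mu]_x F x =
    \int[pushforward mu (-%R : _ -> measurableTypeR R)]_x F x)%E.
  by apply: eq_measure_integral => A mA _; apply/esym/lebesgue_measureN.
by rewrite ge0_integral_pushforward// preimage_setT.
Qed.

End lebesgue_affine.

Section lebesgue_rV_fubini.
Variable R : realType.
Local Notation mu := (@lebesgue_measure R).

Lemma ge0_integral_rV_cons n (F : 'rV[R]_n.+1 -> \bar R) :
  measurable_fun setT F -> (forall x, 0 <= F x)%E ->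
  (\int[lebesgue_rV R n.+1]_x F x =
   \int[mu]_x \int[lebesgue_rV R n]_y F (rV_cons (x, y)))%E.
Proof.
move=> mF F0.
have mc := @measurable_rV_cons R n.
transitivity (\int[(mu \x lebesgue_rV R n)%E]_p F (rV_cons p))%E.
  rewrite /= (eq_measure_integral
    (pushforward (mu \x lebesgue_rV R n)%E (@rV_cons R n)))//.
  by rewrite ge0_integral_pushforward// preimage_setT.
rewrite fubini_tonelli1//.
by apply: measurableT_comp.
Qed.

Lemma rV0_eq0 (x : 'rV[R]_0) : x = 0.
Proof. by apply/rowP => -[]. Qed.

Lemma integral_rV0 (F : 'rV[R]_0 -> \bar R) :
  (\int[lebesgue_rV R 0]_x F x = F 0%R)%E.
Proof.
rewrite /= (_ : F = cst (F 0)); last by apply/funext => x; rewrite (rV0_eq0 x).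
by rewrite integral_cst//= diracT mule1.
Qed.

Lemma measurable_rV_affine n (a : R) (b : 'rV[R]_n) :
  measurable_fun setT (fun x : 'rV[R]_n => b + a *: x).
Proof.
apply: measurable_fun_rV => i; under eq_fun do rewrite !mxE.
apply: measurable_funD => //.
by apply: measurable_funM => //; exact: measurable_coord.
Qed.

Lemma rV_consE n (x : 'rV[R]_n.+1) :
  x = rV_cons (x ord0 ord0 : measurableTypeR R, \row_i x ord0 (lift ord0 i)).
Proof.
apply/rowP => i; have [j ->|->] := unliftP ord0 i.
  by rewrite rV_consS mxE.
by rewrite rV_cons0.
Qed.

Lemma rV_cons_affine n (a b0 x : R) (b y : 'rV[R]_n) :
  rV_cons (b0 : measurableTypeR R, b) + a *: rV_cons (x : measurableTypeR R, y) =
  rV_cons ((b0 + a * x)%R : measurableTypeR R, b + a *: y).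
Proof.
apply/rowP => i; rewrite [LHS]mxE [X in _ + X]mxE.
by have [j ->|->] := unliftP ord0 i; rewrite ?rV_consS ?rV_cons0// !mxE.
Qed.

Lemma measurable_fun_slice d d' (T1 : measurableType d) (T2 : measurableType d')
  (d3 : measure_display) (T3 : measurableType d3) (F : T1 * T2 -> T3) x :
  measurable_fun setT F -> measurable_fun setT (fun y => F (x, y)).
Proof. by move=> mF; apply: measurableT_comp => //; exact: measurable_pair1. Qed.

Lemma ge0_integral_rV_affine n (a : R) (b : 'rV[R]_n) (F : 'rV[R]_n -> \bar R) :
  0 < a -> measurable_fun setT F -> (forall x, 0 <= F x)%E ->
  (\int[lebesgue_rV R n]_x F x =
   (a ^+ n)%:E * \int[lebesgue_rV R n]_x F (b + a *: x)%R)%E.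
Proof.
move=> a0; elim: n b F => [|n IH] b F mF F0.
  rewrite !integral_rV0 expr0 mul1e; congr F; exact/esym/rV0_eq0.
have mFc : measurable_fun setT (fun p : measurableTypeR R * 'rV[R]_n => F (rV_cons p)).
  by apply: measurableT_comp => //; exact: measurable_rV_cons.
have mFa : measurable_fun setT (fun x : 'rV[R]_n.+1 => F (b + a *: x)).
  by apply: measurableT_comp => //; exact: measurable_rV_affine.
rewrite !ge0_integral_rV_cons//.
rewrite exprS EFinM.
rewrite (@ge0_integral_affine R a (b ord0 ord0))//; last 2 first.
  exact: (measurable_fun_fubini_tonelli_F (fun p => F (rV_cons p))).
  by move=> x; exact: integral_ge0.
rewrite -muleA; congr (_ * _)%E.
rewrite -ge0_integralZl//; last 3 first.
  apply: (measurable_fun_fubini_tonelli_F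
    (fun p : measurableTypeR R * 'rV[R]_n => F (b + a *: rV_cons p)%R)) => //.
  by apply: (measurableT_comp mFa); exact: measurable_rV_cons.
  by move=> x _; exact: integral_ge0.
  by rewrite lee_fin exprn_ge0// ltW.
apply: eq_integral => x _.
rewrite (IH (\row_i b ord0 (lift ord0 i)))//; last first.
  exact: (measurable_fun_slice (F := fun p => F (rV_cons p))).
congr (_ * _)%E; apply: eq_integral => y _.
by rewrite [in RHS](rV_consE b) rV_cons_affine.
Qed.

End lebesgue_rV_fubini.

(** * Rotations of the plane *)

Section plane_rotation.
Variable R : realType.
Local Notation mu := (@lebesgue_measure R).
Local Notation RT := (measurableTypeR R).

Lemma ge0_integral_translation (b : R) (F : R -> \bar R) :
  measurable_fun setT F -> (forall x, 0 <= F x)%E ->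
  (\int[mu]_x F x = \int[mu]_x F (x + b)%R)%E.
Proof.
move=> mF F0; rewrite (@ge0_integral_affine R 1 b)// mul1e.
by apply: eq_integral => x _; rewrite mul1r addrC.
Qed.

Lemma ge0_integral_sheary (b : R) (H : RT * RT -> \bar R) :
  measurable_fun setT H -> (forall p, 0 <= H p)%E ->
  (\int[mu]_x \int[mu]_y H (x, y) = \int[mu]_x \int[mu]_y H (x, y + b * x)%R)%E.
Proof.
move=> mH H0; apply: eq_integral => x _.
rewrite (@ge0_integral_translation (b * x))//.
exact: measurable_fun_slice.
Qed.

Lemma ge0_integral_shearx (a : R) (H : RT * RT -> \bar R) :
  measurable_fun setT H -> (forall p, 0 <= H p)%E ->
  (\int[mu]_x \int[mu]_y H (x, y) = \int[mu]_x \int[mu]_y H (x + a * y, y)%R)%E.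
Proof.
move=> mH H0.
have mH' : measurable_fun setT
    (fun p : RT * RT => H ((p.1 + a * p.2)%R : RT, p.2)).
  apply: measurableT_comp => //; apply: measurable_fun_pair => //=.
  apply: measurable_funD => //; apply: measurable_funM => //.
rewrite (fubini_tonelli H)//.
rewrite (fubini_tonelli (fun p : RT * RT => H ((p.1 + a * p.2)%R : RT, p.2)))//.
apply: eq_integral => y _ /=.
rewrite (@ge0_integral_translation (a * y))//.
apply: measurableT_comp => //; exact: measurable_pair2.
Qed.

(** A rotation of angle theta is the composite of three shears, two of them
    horizontal with coefficient a = - s / (1 + c) = - tan (theta / 2). A shear
    translates one variable by a multiple of the other, so it preserves the
    integral by Tonelli's theorem. For c >= 0 the denominator 1 + c does not
    vanish. *)
Lemma ge0_integral_rotation (c s : R) (H : RT * RT -> \bar R) :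
  0 <= c -> c ^+ 2 + s ^+ 2 = 1 ->
  measurable_fun setT H -> (forall p, 0 <= H p)%E ->
  (\int[mu]_x \int[mu]_y H (x, y) =
   \int[mu]_x \int[mu]_y H (c * x - s * y, s * x + c * y)%R)%E.
Proof.
move=> c0 cs mH H0.
have c1 : 1 + c != 0 by rewrite gt_eqF// ltr_pwDl.
pose a : R := - (s / (1 + c)).
have mlin (k1 k2 k3 k4 : R) : measurable_fun setT
    (fun p : RT * RT => H ((k1 * p.1 + k2 * p.2)%R : RT, (k3 * p.1 + k4 * p.2)%R : RT)).
  apply: measurableT_comp => //; apply: measurable_fun_pair => //=;
    by apply: measurable_funD => //; apply: measurable_funM.
have acs : 1 + a * s = c.
  have ss : s * s = (1 - c) * (1 + c) by rewrite -expr2 -[s ^+ 2](addKr (c ^+ 2)) cs; ring.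
  by rewrite /a mulNr mulrAC ss mulfK//; ring.
have acs2 : a + a * c = - s.
  by rewrite -[X in X + _]mulr1 -mulrDr /a mulNr mulfVK.
rewrite (ge0_integral_shearx a mH H0).
pose H1 : RT * RT -> \bar R := fun p => H ((1 * p.1 + a * p.2)%R : RT, (0 * p.1 + 1 * p.2)%R : RT).
transitivity (\int[mu]_x \int[mu]_y H1 (x, y))%E.
  by apply: eq_integral => x _; apply: eq_integral => y _; rewrite /H1/= !mul1r mul0r add0r.
rewrite (@ge0_integral_sheary s H1); [|exact: mlin|by move=> p; exact: H0].
pose H2 : RT * RT -> \bar R :=
  fun p => H ((c * p.1 + a * p.2)%R : RT, (s * p.1 + 1 * p.2)%R : RT).
transitivity (\int[mu]_x \int[mu]_y H2 (x, y))%E.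
  apply: eq_integral => x _; apply: eq_integral => y _; rewrite /H1/H2/= -acs.
  by congr (H (_, _)); ring.
rewrite (@ge0_integral_shearx a H2); [|exact: mlin|by move=> p; exact: H0].
apply: eq_integral => x _; apply: eq_integral => y _; rewrite /H2/=.
congr (H (_, _)).
  transitivity (c * x + (a + a * c) * y); first by ring.
  by rewrite acs2 mulNr.
by rewrite -[in RHS]acs; ring.
Qed.

End plane_rotation.

(** * Fourier transform of a ball *)

Section slice_weights.
Variable R : realType.
Local Notation mu := (@lebesgue_measure R).
Local Notation RT := (measurableTypeR R).

Lemma measurable_fun_cos d (T : measurableType d) (f : T -> RT) :
  measurable_fun setT f -> measurable_fun setT (fun x => cos (f x) : RT).
Proof.
by move=> mf; apply: measurableT_comp => //; apply: continuous_measurable_fun; exact: continuous_cos.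
Qed.

Lemma measurable_fun_sqrt d (T : measurableType d) (f : T -> RT) :
  measurable_fun setT f -> measurable_fun setT (fun x => Num.sqrt (f x) : RT).
Proof.
by move=> mf; apply: measurableT_comp => //; apply: continuous_measurable_fun; exact: sqrt_continuous.
Qed.

(** The test 0 < u matters for m = 0: sqrt_pow 0 is the indicator function of
    the positive reals, so that sqrt_pow m (S - x ^+ 2) vanishes outside the
    interval x ^+ 2 < S for every m. *)
Definition sqrt_pow (m : nat) (u : R) : R := if 0 < u then Num.sqrt u ^+ m else 0.

Lemma sqrt_pow_ge0 m u : 0 <= sqrt_pow m u.
Proof. by rewrite /sqrt_pow; case: ifP => // _; rewrite exprn_ge0// sqrtr_ge0. Qed.

Lemma measurable_sqrt_pow m d (T : measurableType d) (f : T -> RT) :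
  measurable_fun setT f -> measurable_fun setT (fun x => sqrt_pow m (f x) : RT).
Proof.
move=> mf; rewrite /sqrt_pow; apply: measurable_fun_ifT => //.
  exact: measurable_fun_ltr.
by apply: measurable_funX; exact: measurable_fun_sqrt.
Qed.

Lemma sqrt_pow_scale m (S u : R) : 0 < S ->
  sqrt_pow m (S * u) = Num.sqrt S ^+ m * sqrt_pow m u.
Proof.
move=> S0; rewrite /sqrt_pow pmulr_rgt0//; case: ifP => u0; last by rewrite mulr0.
by rewrite sqrtrM ?ltW// exprMn.
Qed.

(** The ratio of the volumes of the unit balls of dimensions m.+1 and m. *)
Definition slice_weight (m : nat) : R := \int[mu]_x sqrt_pow m (1 - x ^+ 2).

Lemma sqrt_pow_le m x : sqrt_pow m (1 - x ^+ 2) <= \1_(`[-1, 1]%classic) x.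
Proof.
rewrite /sqrt_pow subr_gt0; case: ifPn => [x1|_]; last by rewrite indicE ler0n.
rewrite indicE mem_set/=.
  rewrite exprn_ile1 ?sqrtr_ge0//.
  rewrite -[leRHS]sqrtr1 ler_wsqrtr// lerBlDr lerDl sqr_ge0//.
by rewrite in_itv/= -ler_norml -[leRHS]sqrtr1 -sqrtr_sqr ler_wsqrtr// ltW.
Qed.

Lemma measurable_slice m S : measurable_fun setT (fun x : RT => sqrt_pow m (S - x ^+ 2) : RT).
Proof.
apply: measurable_sqrt_pow; apply: measurable_funB => //; exact: measurable_funX.
Qed.

Lemma slice_weightE m :
  (\int[mu]_x (sqrt_pow m (1 - x ^+ 2))%:E = (slice_weight m)%:E)%E.
Proof.
rewrite /slice_weight /Rintegral fineK// ge0_fin_numE; last first.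
  by apply: integral_ge0 => x _; rewrite lee_fin sqrt_pow_ge0.
apply: (@le_lt_trans _ _ (\int[mu]_x (\1_(`[-1, 1]%classic) x)%:E)%E).
  apply: ge0_le_integral => //.
  - by move=> x _; rewrite lee_fin sqrt_pow_ge0.
  - by apply/measurable_EFinP; exact: measurable_slice.
  - by apply/measurable_EFinP; exact: measurable_indic.
  - by move=> x _; rewrite lee_fin sqrt_pow_le.
rewrite integral_indic// setIT. rewrite /= lebesgue_measure_itv/=.
by case: ifP => _; rewrite ltry.
Qed.

(** Substitute y = sqrt S * z. *)
Lemma slice_integral m (S : R) :
  (\int[mu]_y (sqrt_pow m (S - y ^+ 2))%:E = (slice_weight m * sqrt_pow m.+1 S)%:E)%E.
Proof.
have [S0|S0] := ltP 0 S; last first.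
  rewrite {2}/sqrt_pow ltNge S0/= mulr0; apply: integral0_eq => y _.
  by rewrite /sqrt_pow subr_gt0 ltNge (le_trans S0)// sqr_ge0.
rewrite (@ge0_integral_affine R (Num.sqrt S) 0)//; last 3 first.
  by rewrite sqrtr_gt0.
  by apply/measurable_EFinP; exact: measurable_slice.
  by move=> y; rewrite lee_fin sqrt_pow_ge0.
under eq_integral => y _.
  rewrite (_ : S - _ = S * (1 - y ^+ 2)); last first.
    by rewrite add0r exprMn sqr_sqrtr ?ltW// mulrBr mulr1.
  rewrite sqrt_pow_scale// EFinM.
  over.
rewrite ge0_integralZl_EFin//; last 2 first.
  by move=> y _; rewrite lee_fin sqrt_pow_ge0.
  by apply/measurable_EFinP; exact: measurable_slice.
rewrite slice_weightE -!EFinM; congr EFin.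
by rewrite /sqrt_pow S0 exprS; ring.
Qed.

End slice_weights.

Section ball_transform.
Variable R : realType.
Local Notation mu := (@lebesgue_measure R).
Local Notation RT := (measurableTypeR R).

Lemma measurable_fun_dotp n d (T : measurableType d) (f g : T -> 'rV[R]_n) :
  measurable_fun setT f -> measurable_fun setT g ->
  measurable_fun setT (fun x => dotp (f x) (g x) : RT).
Proof.
move=> mf mg; apply: (@measurable_sum _ T R setT _ _ (fun i x => f x ord0 i * g x ord0 i)) => i.
apply: measurable_funM.
  by apply: (measurableT_comp (@measurable_coord R n i)).
by apply: (measurableT_comp (@measurable_coord R n i)).
Qed.

Lemma dotpC n (x y : 'rV[R]_n) : dotp x y = dotp y x.
Proof. by apply: eq_bigr => i _; rewrite mulrC. Qed.

Lemma dotp_ge0 n (x : 'rV[R]_n) : 0 <= dotp x x.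
Proof. by apply: sumr_ge0 => i _; rewrite -expr2 sqr_ge0. Qed.

Lemma norm2_sqr n (x : 'rV[R]_n) : norm2 x ^+ 2 = dotp x x.
Proof. by rewrite sqr_sqrtr// dotp_ge0. Qed.

Lemma norm2_ge0 n (x : 'rV[R]_n) : 0 <= norm2 x.
Proof. exact: sqrtr_ge0. Qed.

Lemma dotp_rV_cons n (x : R) (y : 'rV[R]_n) (t : 'rV[R]_n.+1) :
  dotp (rV_cons (x : RT, y)) t = x * t ord0 ord0 + dotp y (rV_uncons t).2.
Proof.
rewrite /dotp big_ord_recl rV_cons0; congr (_ + _).
by apply: eq_bigr => i _; rewrite rV_consS mxE.
Qed.

Lemma dotp_rV_cons2 n (x : R) (y : 'rV[R]_n) :
  dotp (rV_cons (x : RT, y)) (rV_cons (x : RT, y)) = x ^+ 2 + dotp y y.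
Proof.
rewrite dotp_rV_cons rV_cons0 expr2; congr (_ + dotp _ _).
by apply/rowP => i; rewrite mxE rV_consS.
Qed.

Lemma dotp_uncons n (t : 'rV[R]_n.+1) :
  dotp t t = t ord0 ord0 ^+ 2 + norm2 (rV_uncons t).2 ^+ 2.
Proof.
rewrite norm2_sqr [in LHS](rV_consE t) dotp_rV_cons2; congr (_ ^+ 2 + dotp _ _).
Qed.

(** The volume of the unit ball of dimension n, built up slice by slice; see
    integral_ball_ind. *)
Definition ball_coef n : R := \prod_(i < n) slice_weight R i.

Lemma ball_coefS n : ball_coef n.+1 = ball_coef n * slice_weight R n.
Proof. by rewrite /ball_coef big_ord_recr. Qed.

Lemma slice_weight_ge0 n : 0 <= slice_weight R n.
Proof. by apply: Rintegral_ge0 => x _; exact: sqrt_pow_ge0. Qed.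

Lemma ball_coef_ge0 n : 0 <= ball_coef n.
Proof. by apply: prodr_ge0 => i _; exact: slice_weight_ge0. Qed.

Lemma cosD1_ge0 (x : R) : 0 <= 1 + cos x.
Proof. by rewrite -lerBlDl sub0r cos_geN1. Qed.

Lemma measurable_wave_ball n m S a (t : 'rV[R]_n) : measurable_fun setT
  (fun x : 'rV[R]_n => ((1 + cos (2 * pi * dotp x t + a)) * sqrt_pow m (S - dotp x x))%:E).
Proof.
apply/measurable_EFinP; apply: measurable_funM.
  apply: measurable_funD => //; apply: measurable_fun_cos.
  by apply: measurable_funD => //; apply: measurable_funM => //; exact: measurable_fun_dotp.
apply: measurable_sqrt_pow; apply: measurable_funB => //; exact: measurable_fun_dotp.
Qed.

Lemma measurable_wave_slice m S a (k : R) : measurable_fun setT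
  (fun y : RT => ((1 + cos (2 * pi * k * y + a)) * sqrt_pow m (S - y ^+ 2))%:E).
Proof.
apply/measurable_EFinP; apply: measurable_funM; last exact: measurable_slice.
apply: measurable_funD => //; apply: measurable_fun_cos.
by apply: measurable_funD => //; apply: measurable_funM.
Qed.

(** The rotation that takes (k0, k1) to the second axis leaves the weight
    unchanged and makes the wave depend on one variable only. *)
Lemma wave_plane_rotate (m : nat) (S a k0 k1 : R) : 0 <= k1 ->
  (\int[mu]_x \int[mu]_y ((1 + cos (2 * pi * (k0 * x + k1 * y) + a)) *
     sqrt_pow m (S - (x ^+ 2 + y ^+ 2)))%:E =
   \int[mu]_y \int[mu]_x ((1 + cos (2 * pi * Num.sqrt (k0 ^+ 2 + k1 ^+ 2) * y + a)) *
     sqrt_pow m (S - (x ^+ 2 + y ^+ 2)))%:E)%E.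
Proof.
move=> k1_ge0; set tau := Num.sqrt _.
have tau2 : tau ^+ 2 = k0 ^+ 2 + k1 ^+ 2 by rewrite sqr_sqrtr// addr_ge0 ?sqr_ge0.
have [c [s [c0 cs e1 e2]]] : exists c s, [/\ 0 <= c, c ^+ 2 + s ^+ 2 = 1,
    k0 * c + k1 * s = 0 & k1 * c - k0 * s = tau].
  have [t0|t0] := eqVneq tau 0.
    exists 1, 0; move/eqP: tau2; rewrite t0 expr0n/= eq_sym paddr_eq0 ?sqr_ge0//.
    rewrite !sqrf_eq0 => /andP[/eqP-> /eqP->].
    by split; rewrite ?mulr0 ?mul0r ?addr0 ?subr0 ?expr1n ?expr0n ?addr0.
  exists (k1 / tau), (- (k0 / tau)); split.
  - by rewrite divr_ge0// sqrtr_ge0.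
  - by rewrite sqrrN !expr_div_n -mulrDl addrC -tau2 divff// expf_neq0.
  - by rewrite mulrN mulrCA subrr.
  - rewrite mulrN opprK !mulrA -mulrDl -!expr2 addrC -tau2 expr2 mulfK//.
pose H (p : RT * RT) := ((1 + cos (2 * pi * (k0 * p.1 + k1 * p.2) + a)) *
     sqrt_pow m (S - (p.1 ^+ 2 + p.2 ^+ 2)))%:E.
have mS : measurable_fun setT (fun p : RT * RT => sqrt_pow m (S - (p.1 ^+ 2 + p.2 ^+ 2)) : RT).
  apply: measurable_sqrt_pow; apply: measurable_funB => //.
  by apply: measurable_funD; apply: measurable_funX.
have mH : measurable_fun setT H.
  apply/measurable_EFinP; apply: measurable_funM => //.
  apply: measurable_funD => //; apply: measurable_fun_cos.
  apply: measurable_funD => //; apply: measurable_funM => //.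
  by apply: measurable_funD => //; apply: measurable_funM.
have H0 p : (0 <= H p)%E by rewrite lee_fin mulr_ge0 ?cosD1_ge0 ?sqrt_pow_ge0.
rewrite (ge0_integral_rotation c0 cs mH H0).
pose G (p : RT * RT) := ((1 + cos (2 * pi * tau * p.2 + a)) *
     sqrt_pow m (S - (p.1 ^+ 2 + p.2 ^+ 2)))%:E.
transitivity (\int[mu]_x \int[mu]_y G (x, y))%E.
  apply: eq_integral => x _; apply: eq_integral => y _; rewrite /H /G/=.
  congr ((1 + cos (_ + a)) * sqrt_pow m (S - _))%:E.
    rewrite -(mulrA _ tau y); congr (_ * _).
    transitivity ((k0 * c + k1 * s) * x + (k1 * c - k0 * s) * y); first by ring.
    by rewrite e1 e2 mul0r add0r.
  by rewrite -[RHS]mul1r -cs; ring.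
rewrite (fubini_tonelli G)//.
apply/measurable_EFinP; apply: measurable_funM => //.
apply: measurable_funD => //; apply: measurable_fun_cos.
by apply: measurable_funD => //; apply: measurable_funM.
by move=> p; rewrite lee_fin mulr_ge0 ?cosD1_ge0 ?sqrt_pow_ge0.
Qed.

(** Fourier transform of a ball as a one-dimensional integral. By induction on
    the dimension: slice along the first coordinate x, apply the induction
    hypothesis to the slice with the phase shifted by 2 * pi * t_0 * x, rotate
    the plane of the two remaining variables, and integrate out the one on which
    the wave no longer depends. Adding 1 to the cosine keeps every integrand
    nonnegative, as Tonelli's theorem requires; the phase a is what makes the
    induction go through. *)
Lemma wave_ball_transform n (S a : R) (t : 'rV[R]_n.+1) :
  (\int[lebesgue_rV R n.+1]_x
     ((1 + cos (2 * pi * dotp x t + a)) * sqrt_pow 0 (S - dotp x x))%:E =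
   (ball_coef n)%:E *
   \int[mu]_y ((1 + cos (2 * pi * norm2 t * y + a)) * sqrt_pow n (S - y ^+ 2))%:E)%E.
Proof.
elim: n S a t => [|n IH] S a t.
  rewrite /ball_coef big_ord0 mul1e ge0_integral_rV_cons; last 2 first.
    exact: measurable_wave_ball.
    by move=> x; rewrite lee_fin mulr_ge0 ?cosD1_ge0 ?sqrt_pow_ge0.
  under eq_integral do rewrite integral_rV0 dotp_rV_cons dotp_rV_cons2 /dotp !big_ord0 !addr0.
  rewrite /norm2 dotp_uncons norm2_sqr /dotp big_ord0 addr0 sqrtr_sqr.
  have [t0|t0] := ger0P (t ord0 ord0).
    by apply: eq_integral => x _; rewrite [x * _]mulrC mulrA.
  rewrite [RHS]ge0_integral_oppr; last 2 first.
    exact: measurable_wave_slice.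
    by move=> x; rewrite lee_fin mulr_ge0 ?cosD1_ge0 ?sqrt_pow_ge0.
  by apply: eq_integral => x _; congr ((1 + cos _) * sqrt_pow 0 _)%:E; ring.
rewrite ge0_integral_rV_cons; last 2 first.
  exact: measurable_wave_ball.
  by move=> x; rewrite lee_fin mulr_ge0 ?cosD1_ge0 ?sqrt_pow_ge0.
set t' := (rV_uncons t).2.
transitivity (\int[mu]_x ((ball_coef n)%:E * \int[mu]_y
    ((1 + cos (2 * pi * (t ord0 ord0 * x + norm2 t' * y) + a)) *
     sqrt_pow n (S - (x ^+ 2 + y ^+ 2)))%:E))%E.
  apply: eq_integral => x _.
  transitivity (\int[lebesgue_rV R n.+1]_y
     ((1 + cos (2 * pi * dotp y t' + (2 * pi * (t ord0 ord0 * x) + a)))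
       * sqrt_pow 0 ((S - x ^+ 2) - dotp y y))%:E)%E.
    apply: eq_integral => y _; rewrite dotp_rV_cons dotp_rV_cons2 -/t'.
    by congr ((1 + cos _) * sqrt_pow 0 _)%:E; ring.
  rewrite IH; congr (_ * _)%E; apply: eq_integral => y _.
  by congr ((1 + cos _) * sqrt_pow n _)%:E; ring.
pose P (p : RT * RT) :=
   ((1 + cos (2 * pi * (t ord0 ord0 * p.1 + norm2 t' * p.2) + a)) *
     sqrt_pow n (S - (p.1 ^+ 2 + p.2 ^+ 2)))%:E.
have mP : measurable_fun setT P.
  apply/measurable_EFinP; apply: measurable_funM => //.
    apply: measurable_funD => //; apply: measurable_fun_cos.
    apply: measurable_funD => //; apply: measurable_funM => //.
    by apply: measurable_funD => //; apply: measurable_funM.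
  apply: measurable_sqrt_pow; apply: measurable_funB => //.
  by apply: measurable_funD; apply: measurable_funX.
have P0 p : (0 <= P p)%E.
  by rewrite lee_fin mulr_ge0 ?cosD1_ge0 ?sqrt_pow_ge0.
rewrite ge0_integralZl_EFin//; last 3 first.
  by move=> x _; apply: integral_ge0 => y _; exact: (P0 (x, y)).
  exact: (measurable_fun_fubini_tonelli_F P).
  exact: ball_coef_ge0.
rewrite wave_plane_rotate ?norm2_ge0// -dotp_uncons -/(norm2 t).
rewrite ball_coefS EFinM -muleA; congr (_ * _)%E.
rewrite -ge0_integralZl_EFin//; last 3 first.
  by move=> x _; rewrite lee_fin mulr_ge0 ?cosD1_ge0 ?sqrt_pow_ge0.
  exact: measurable_wave_slice.
  exact: slice_weight_ge0.
apply: eq_integral => y _.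
under eq_integral => x _ do rewrite EFinM opprD addrA (addrAC S).
rewrite ge0_integralZl_EFin ?cosD1_ge0//; last 2 first.
  by move=> x _; rewrite lee_fin sqrt_pow_ge0.
  by apply/measurable_EFinP; exact: measurable_slice.
by rewrite slice_integral -!EFinM; congr EFin; ring.
Qed.

End ball_transform.

(** * The Poisson kernel and its transform *)

Lemma derivable_continuous (R : realType) (f : R -> R) (x : R) :
  derivable f x 1 -> {for x, continuous f}.
Proof. by move=> df; apply: differentiable_continuous; exact/derivable1_diffP. Qed.

Section poisson_kernel.
Variable R : realType.
Local Notation mu := (@lebesgue_measure R).
Local Notation RT := (measurableTypeR R).

(** The Fourier transform of t |-> expR (- `|t|); see integral_expRN_abs_wave. *)
Definition poisson1 (x : R) : R := 2 / (1 + (2 * pi * x) ^+ 2).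

Lemma denom_gt0 (b : R) : 0 < 1 + b ^+ 2.
Proof. by rewrite ltr_pwDl// sqr_ge0. Qed.

(** The condition B <= A makes the integrand nonnegative; it has the elementary
    primitive F below. *)
Lemma integral_expRN_wave0y (A B a b : R) : 0 <= B -> B <= A ->
  (\int[mu]_(t in `[0%R, +oo[) (expR (- t) * (A + B * cos (b * t + a)))%:E =
   (A + B * (cos a - b * sin a) / (1 + b ^+ 2))%:E)%E.
Proof.
move=> B0 BA.
pose f t := expR (- t) * (A + B * cos (b * t + a)).
pose D := 1 + b ^+ 2.
have D0 : D != 0 by rewrite gt_eqF// denom_gt0.
pose F t := expR (- t) * (B / D * (b * sin (b * t + a) - cos (b * t + a)) - A).
have dF (x : R) : is_derive x 1 F (f x).
  rewrite /F; apply: is_derive_eq.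
  rewrite /f /GRing.scale/=.
  by rewrite -[B in RHS](mulfVK D0) /D; ring.
have ch t : `|B / D * (b * sin (b * t + a) - cos (b * t + a)) - A| <= B / D * (`|b| + 1) + A.
  rewrite (le_trans (ler_normB _ _))// lerD//; last by rewrite ger0_norm// (le_trans B0).
  have BD0 : 0 <= B / D by rewrite divr_ge0// ltW// denom_gt0.
  rewrite normrM (ger0_norm BD0) ler_wpM2l//.
  rewrite (le_trans (ler_normB _ _))// lerD//; last by rewrite ler_norml cos_geN1 cos_le1.
  by rewrite normrM ler_piMr// ler_norml sin_geN1 sin_le1.
have cosn (t : R) : -1 <= cos t <= 1 by rewrite cos_geN1 cos_le1.
have cF (x : R) : {for x, continuous F}.
  by apply: derivable_continuous; case: (dF x).
have -> : (A + B * (cos a - b * sin a) / (1 + b ^+ 2))%:E = (0%:E - (F 0)%:E)%E.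
  rewrite -EFinB /F oppr0 expR0 mul1r mulr0 !add0r; congr EFin.
  by rewrite -/D; field.
apply: (@ge0_continuous_FTC2y R f F 0 0).
- move=> x _; rewrite mulr_ge0 ?expR_ge0//.
  have /andP[c1 _] := cosn (b * x + a).
  rewrite (le_trans _ (_ : A + B * -1 <= _))//; first by rewrite mulrN1 subr_ge0.
  by rewrite lerD2l ler_wpM2l.
- by apply: continuous_subspaceT => x; apply: derivable_continuous; exact: ex_derive.
- apply: (@squeeze_cvgr _ _ _ _ (fun t => - (expR (- t) * (B / D * (`|b| + 1) + A)))
    (fun t => expR (- t) * (B / D * (`|b| + 1) + A))).
  + apply: nearW => t; rewrite -ler_norml /F normrM ger0_norm ?expR_ge0//.
    by rewrite ler_wpM2l ?expR_ge0.
  + rewrite -oppr0; apply: cvgN; rewrite -[X in _ --> X](mul0r (B / D * (`|b| + 1) + A)).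
    by apply: cvgM; [exact: cvgr_expR|exact: cvg_cst].
  + rewrite -[X in _ --> X](mul0r (B / D * (`|b| + 1) + A)).
    by apply: cvgM; [exact: cvgr_expR|exact: cvg_cst].
- by move=> x _; case: (dF x).
- by apply: cvg_at_right_filter; exact: cF.
- by move=> x _; rewrite derive1E; case: (dF x).
Qed.

Lemma ge0_integral_halves (G : R -> \bar R) :
  measurable_fun setT G -> (forall x, 0 <= G x)%E ->
  (\int[mu]_x G x = \int[mu]_(x in `[0%R, +oo[) G x + \int[mu]_(x in `[0%R, +oo[) G (- x)%R)%E.
Proof.
move=> mG G0.
have mGN : measurable_fun setT (fun x : RT => G (- x)).
  by apply: (measurableT_comp mG); exact: oppr_measurable.
rewrite [X in (_ + X)%E]ge0_integration_by_substitution0//.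
rewrite -(setUv (`[0%R, +oo[%classic : set R)) ge0_integral_setU//=; last 3 first.
  exact: measurableC.
  by rewrite setUv.
  exact/disj_setPCl.
rewrite setCitvr; congr (_ + _)%E.
rewrite integral_itv_bndo_bndc; last exact: measurable_funTS.
by apply: eq_integral => x _; rewrite opprK.
Qed.

Lemma measurable_expRN_abs_wave (A B a b : R) :
  measurable_fun setT (fun t : RT => (expR (- `|t|) * (A + B * cos (b * t + a)))%:E).
Proof.
apply/measurable_EFinP; apply: measurable_funM.
  by apply: measurableT_comp => //; apply: measurableT_comp.
apply: measurable_funD => //; apply: measurable_funM => //.
by apply: measurable_fun_cos; apply: measurable_funD => //; apply: measurable_funM.
Qed.

Lemma wave_ge0 (A B x : R) : 0 <= B -> B <= A -> 0 <= A + B * cos x.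
Proof.
move=> B0 BA; apply: (@le_trans _ _ (A + B * -1)); first by rewrite mulrN1 subr_ge0.
by rewrite lerD2l ler_wpM2l// cos_geN1.
Qed.

Lemma integral_expRN_abs_wave (A B a x : R) : 0 <= B -> B <= A ->
  (\int[mu]_t (expR (- `|t|) * (A + B * cos (2 * pi * x * t + a)))%:E =
   (2 * A + B * (cos a * poisson1 x))%:E)%E.
Proof.
move=> B0 BA; rewrite ge0_integral_halves; last 2 first.
  exact: measurable_expRN_abs_wave.
  by move=> t; rewrite lee_fin mulr_ge0 ?expR_ge0// wave_ge0.
set b := 2 * pi * x.
transitivity ((A + B * (cos a - b * sin a) / (1 + b ^+ 2))%:E +
    (A + B * (cos a - (- b) * sin a) / (1 + (- b) ^+ 2))%:E)%E.
  rewrite -!integral_expRN_wave0y//; congr (_ + _)%E; apply: eq_integral => t;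
    rewrite inE/= in_itv/= andbT => t0; rewrite ?normrN ger0_norm//.
  by rewrite mulrN mulNr.
rewrite -EFinD /poisson1 -/b sqrrN; congr EFin.
have D0 : 1 + b ^+ 2 != 0 by rewrite gt_eqF// denom_gt0.
by field.
Qed.

Lemma poisson1_gt0 x : 0 < poisson1 x.
Proof. by rewrite divr_gt0// denom_gt0. Qed.

Lemma poisson1_le2 x : poisson1 x <= 2.
Proof. by rewrite ler_pdivrMr ?denom_gt0// ler_peMr// lerDl sqr_ge0. Qed.

Lemma continuous_poisson1 : continuous poisson1.
Proof.
move=> x; rewrite /poisson1 /continuous_at; apply: cvgM; first exact: cvg_cst.
apply: (@continuous_comp _ _ _ (fun y => 2 * pi * y) (fun z => (1 + z ^+ 2)^-1)).
  exact: mulrl_continuous.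
exact: continuous_oneDsqrV.
Qed.

Lemma measurable_poisson1 : measurable_fun setT (poisson1 : RT -> RT).
Proof. exact: continuous_measurable_fun continuous_poisson1. Qed.

Lemma integral_poisson1 : (\int[mu]_x (poisson1 x)%:E = 1)%E.
Proof.
have pi2 : 0 < 2 * pi :> R by apply: mulr_gt0 => //; exact: pi_gt0.
rewrite (@ge0_integral_affine R (2 * pi)^-1 0); last 3 first.
  by rewrite invr_gt0.
  by apply/measurable_EFinP; exact: measurable_poisson1.
  by move=> x; rewrite lee_fin ltW// poisson1_gt0.
under eq_integral => x _.
  rewrite /poisson1 add0r mulVKf ?gt_eqF// EFinM.
  over.
have mV : measurable_fun setT (fun x : RT => ((1 + x ^+ 2)^-1)%:E).
  apply/measurable_EFinP; apply: continuous_measurable_fun.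
  exact: continuous_oneDsqrV.
rewrite ge0_integralZl_EFin//; last first.
  by move=> x _; rewrite lee_fin invr_ge0 ltW// denom_gt0.
rewrite ge0_integral_halves//; last first.
  by move=> x; rewrite lee_fin invr_ge0 ltW// denom_gt0.
under [X in (_ + X)%E]eq_integral do rewrite sqrrN.
rewrite integral0y_oneDsqr -EFinD -!EFinM; congr EFin.
have pn0 : pi != 0 :> R by rewrite gt_eqF ?pi_gt0.
by move: pn0; generalize (pi : R) => p pn0; field.
Qed.

End poisson_kernel.

Section rV_kernels.
Variable R : realType.
Local Notation RT := (measurableTypeR R).

(** A product of one-dimensional kernels, rather than a radial one: the transform
    is again a product and everything reduces to dimension one. *)
Definition damping n (t : 'rV[R]_n) : R := \prod_(i < n) expR (- `|t ord0 i|).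
Definition poisson n (x : 'rV[R]_n) : R := \prod_(i < n) poisson1 (x ord0 i).

Lemma damping_cons n (x : R) (y : 'rV[R]_n) :
  damping (rV_cons (x : RT, y)) = expR (- `|x|) * damping y.
Proof.
rewrite /damping big_ord_recl rV_cons0; congr (_ * _).
by apply: eq_bigr => i _; rewrite rV_consS.
Qed.

Lemma poisson_cons n (x : R) (y : 'rV[R]_n) :
  poisson (rV_cons (x : RT, y)) = poisson1 x * poisson y.
Proof.
rewrite /poisson big_ord_recl rV_cons0; congr (_ * _).
by apply: eq_bigr => i _; rewrite rV_consS.
Qed.

Lemma damping_ge0 n (t : 'rV[R]_n) : 0 <= damping t.
Proof. by apply: prodr_ge0 => i _; exact: expR_ge0. Qed.

Lemma poisson_ge0 n (x : 'rV[R]_n) : 0 <= poisson x.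
Proof. by apply: prodr_ge0 => i _; rewrite ltW// poisson1_gt0. Qed.

Lemma poisson_le n (x : 'rV[R]_n) : poisson x <= 2 ^+ n.
Proof.
rewrite -[n in 2 ^+ n]card_ord -prodr_const; apply: ler_prod => i _.
by rewrite poisson1_le2 ltW ?poisson1_gt0.
Qed.

Lemma measurable_damping n : measurable_fun setT (@damping n : _ -> RT).
Proof.
apply: (@measurable_prod _ 'rV[R]_n R setT _ _ (fun i t => expR (- `|t ord0 i|))) => i _.
apply: measurableT_comp => //; apply: measurableT_comp => //; apply: measurableT_comp => //.
exact: measurable_coord.
Qed.

Lemma measurable_poisson n : measurable_fun setT (@poisson n : _ -> RT).
Proof.
apply: (@measurable_prod _ 'rV[R]_n R setT _ _ (fun i t => poisson1 (t ord0 i))) => i _.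
apply: (measurableT_comp (@measurable_poisson1 R)); exact: measurable_coord.
Qed.

Lemma measurable_damping_wave n (x : 'rV[R]_n) a : measurable_fun setT
  (fun t : 'rV[R]_n => (damping t * (1 + cos (2 * pi * dotp t x + a)))%:E).
Proof.
apply/measurable_EFinP; apply: measurable_funM; first exact: measurable_damping.
apply: measurable_funD => //; apply: measurable_fun_cos.
by apply: measurable_funD => //; apply: measurable_funM => //; exact: measurable_fun_dotp.
Qed.

(** The summand 1 contributes the total mass 2 ^+ n of the damping, and keeps the
    integrand nonnegative. Integrating out all coordinates but the first leaves
    the one-dimensional integral with A = 2 ^+ n and B the Poisson kernel of the
    other coordinates. *)
Lemma integral_damping_wave n (x : 'rV[R]_n) a :
  (\int[lebesgue_rV R n]_t (damping t * (1 + cos (2 * pi * dotp t x + a)))%:E =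
   (2 ^+ n + cos a * poisson x)%:E)%E.
Proof.
elim: n x a => [|n IH] x a.
  rewrite integral_rV0 /damping /poisson /dotp !big_ord0 mul1r mulr1 expr0.
  by rewrite mulr0 add0r.
rewrite ge0_integral_rV_cons; last 2 first.
  exact: measurable_damping_wave.
  by move=> t; rewrite lee_fin mulr_ge0 ?damping_ge0 ?cosD1_ge0.
set x' := (rV_uncons x).2.
transitivity (\int[@lebesgue_measure R]_t (expR (- `|t|) *
    (2 ^+ n + poisson x' * cos (2 * pi * x ord0 ord0 * t + a)))%:E)%E.
  apply: eq_integral => t0 _.
  rewrite EFinM mulrC -(mulrC (cos _)) -IH -ge0_integralZl_EFin; last 4 first.
  - by [].
  - by move=> t _; rewrite lee_fin mulr_ge0 ?damping_ge0 ?cosD1_ge0.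
  - exact: measurable_damping_wave.
  - exact: expR_ge0.
  apply: eq_integral => t _; rewrite dotp_rV_cons damping_cons -EFinM -mulrA.
  by congr (_ * (_ * (1 + cos _)))%:E; rewrite -/x'; ring.
rewrite integral_expRN_abs_wave ?poisson_ge0 ?poisson_le//.
rewrite exprS [in RHS](rV_consE x) poisson_cons; congr EFin.
by rewrite -/(rV_uncons x).2 -/x'; ring.
Qed.

Lemma integral_poisson n : (\int[lebesgue_rV R n]_x (poisson x)%:E = 1)%E.
Proof.
elim: n => [|n IH]; first by rewrite integral_rV0 /poisson big_ord0.
rewrite ge0_integral_rV_cons; last 2 first.
  by apply/measurable_EFinP; exact: measurable_poisson.
  by move=> x; rewrite lee_fin poisson_ge0.
rewrite -[RHS](integral_poisson1 R); apply: eq_integral => x _.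
under eq_integral do rewrite poisson_cons EFinM.
rewrite ge0_integralZl_EFin ?IH ?mule1 ?ltW ?poisson1_gt0//.
  by move=> y _; rewrite lee_fin poisson_ge0.
by apply/measurable_EFinP; exact: measurable_poisson.
Qed.

End rV_kernels.

(** * Pairing with cosine transforms *)

Section integrability.
Context d (T : measurableType d) (R : realType).
Variable mu : {measure set T -> \bar R}.
Local Notation RT := (measurableTypeR R).

Lemma integrable_mul_bounded (g h : T -> R) (M : R) :
  mu.-integrable setT (EFin \o g) -> measurable_fun setT (h : T -> RT) ->
  (forall x, `|h x| <= M) -> mu.-integrable setT (EFin \o (fun x => g x * h x)).
Proof.
move=> ig mh hM; have mg : measurable_fun setT (g : T -> RT).
  by apply/measurable_EFinP; exact: measurable_int ig.
apply: (@le_integrable _ _ _ mu setT measurableT _ (fun x => M%:E * (EFin \o g) x)%E).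
- by apply/measurable_EFinP; apply: measurable_funM.
- move=> x _ /=; rewrite lee_fin !normrM mulrC ler_wpM2r//.
  by rewrite (le_trans (hM x))// ler_norm.
- exact: integrableZl.
Qed.

Lemma Rintegral_wave (g th : T -> R) :
  (forall x, 0 <= g x) -> mu.-integrable setT (EFin \o g) ->
  measurable_fun setT (th : T -> RT) ->
  (\int[mu]_x (g x * (1 + cos (th x)))%:E =
   (\int[mu]_x g x + \int[mu]_x (g x * cos (th x)))%R%:E)%E.
Proof.
move=> g0 ig mth.
have ic : mu.-integrable setT (EFin \o (fun x => g x * cos (th x))).
  apply: (@integrable_mul_bounded _ _ 1) => //; first exact: measurable_fun_cos.
  by move=> x; rewrite ler_norml cos_geN1 cos_le1.
rewrite -RintegralD// /Rintegral fineK; first by apply: eq_integral => x _; rewrite mulrDr mulr1.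
apply: integrable_fin_num => //.
rewrite (_ : (fun x => _) = (EFin \o g) \+ (EFin \o (fun x => g x * cos (th x)))); last first.
  by apply/funext => x.
exact: integrableD.
Qed.

End integrability.

Section cosine_transform.
Variables (R : realType) (n : nat).
Local Notation RT := (measurableTypeR R).
Local Notation la := (lebesgue_rV R n).

Definition cosft (g : 'rV[R]_n -> R) (t : 'rV[R]_n) : R :=
  \int[la]_x (g x * cos (2 * pi * dotp x t)).

Lemma measurable_phase (t : 'rV[R]_n) (a : R) :
  measurable_fun setT (fun x : 'rV[R]_n => 2 * pi * dotp x t + a : RT).
Proof.
by apply: measurable_funD => //; apply: measurable_funM => //; exact: measurable_fun_dotp.
Qed.

Lemma measurable_cos_phase (t : 'rV[R]_n) :
  measurable_fun setT (fun x : 'rV[R]_n => cos (2 * pi * dotp x t) : RT).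
Proof.
by apply: measurable_fun_cos; apply: measurable_funM => //; exact: measurable_fun_dotp.
Qed.

Lemma normr_cos_le1 (x : R) : `|cos x| <= 1.
Proof. by rewrite ler_norml cos_geN1 cos_le1. Qed.

Lemma integrable_cos (g : 'rV[R]_n -> R) t : la.-integrable setT (EFin \o g) ->
  la.-integrable setT (EFin \o (fun x => g x * cos (2 * pi * dotp x t))).
Proof.
move=> ig; apply: (@integrable_mul_bounded _ _ _ _ _ _ 1) => //.
  exact: measurable_cos_phase.
by move=> x; exact: normr_cos_le1.
Qed.

Lemma cosft_le (g : 'rV[R]_n -> R) t : la.-integrable setT (EFin \o g) ->
  `|cosft g t| <= \int[la]_x `|g x|.
Proof.
move=> ig; apply: (le_trans (le_normr_Rintegral _ _)) => //.
  exact: integrable_cos.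
apply: le_Rintegral => //.
- exact: integrable_norm (integrable_cos t ig).
- exact: integrable_norm ig.
by move=> x _; rewrite normrM ler_piMr// normr_cos_le1.
Qed.

(** The multiplication formula, by Fubini's theorem: both sides are the integral
    of q t * g x * cos (2 * pi * <x, t>) over the product. *)
Lemma cosft_pairing (q g : 'rV[R]_n -> R) :
  la.-integrable setT (EFin \o q) -> la.-integrable setT (EFin \o g) ->
  la.-integrable setT (EFin \o (fun t => q t * cosft g t)) /\
  \int[la]_t (q t * cosft g t) = \int[la]_x (g x * cosft q x).
Proof.
move=> iq ig.
have mq : measurable_fun setT (q : _ -> RT) by apply/measurable_EFinP; exact: measurable_int iq.
have mg : measurable_fun setT (g : _ -> RT) by apply/measurable_EFinP; exact: measurable_int ig.
pose G (p : 'rV[R]_n * 'rV[R]_n) : \bar R :=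
  (q p.1 * (g p.2 * cos (2 * pi * dotp p.2 p.1)))%:E.
have mG : measurable_fun setT G.
  apply/measurable_EFinP; apply: measurable_funM; first exact: measurableT_comp.
  apply: measurable_funM; first exact: measurableT_comp.
  by apply: measurable_fun_cos; apply: measurable_funM => //; exact: measurable_fun_dotp.
have inn t : (\int[la]_x G (t, x) = (q t * cosft g t)%:E)%E.
  rewrite /G/= /cosft -RintegralZl//; last exact: integrable_cos.
  rewrite /Rintegral fineK//; apply: integrable_fin_num => //.
  have := integrableZl measurableT (q t) (integrable_cos t ig).
  by apply: eq_integrable => // x _ /=; rewrite -EFinM.
have inn2 x : (\int[la]_t G (t, x) = (g x * cosft q x)%:E)%E.
  rewrite /G/= /cosft -RintegralZl//; last exact: integrable_cos.
  rewrite /Rintegral fineK//.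
    by apply: eq_integral => t _; rewrite mulrCA dotpC.
  apply: integrable_fin_num => //.
  have := integrableZl measurableT (g x) (integrable_cos x iq).
  by apply: eq_integrable => // t _ /=; rewrite -EFinM.
have iG : (la \x la)%E.-integrable setT G.
  apply/integrable12ltyP; first exact: mG.
  apply: (@le_lt_trans _ _ (\int[la]_t (`|q t|%:E * \int[la]_x `|g x|%:E))%E).
    apply: ge0_le_integral => //.
    - by move=> t _; exact: integral_ge0.
    - apply: (measurable_fun_fubini_tonelli_F (fun p => `|G p|)%E) => //.
      exact: measurableT_comp.
    - by apply: emeasurable_funM => //; apply/measurable_EFinP; exact: measurableT_comp.
    - move=> t _; rewrite -ge0_integralZl_EFin//; last first.
        by apply/measurable_EFinP; exact: measurableT_comp.
      apply: ge0_le_integral => //.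
      + apply: measurableT_comp => //; exact: measurable_fun_slice.
      + by apply: emeasurable_funM => //; apply/measurable_EFinP; exact: measurableT_comp.
      + by move=> x _; rewrite /G/= -EFinM lee_fin !normrM ler_wpM2l// ler_piMr// normr_cos_le1.
  have [_ gfin] := integrableP _ _ _ ig; have [_ qfin] := integrableP _ _ _ iq.
  have gE : (\int[la]_x `|g x|%:E = (\int[la]_x `|g x|)%R%:E)%E.
    by rewrite /Rintegral fineK// ge0_fin_numE ?integral_ge0.
  rewrite gE; under eq_integral do rewrite muleC.
  rewrite ge0_integralZl_EFin//; last 2 first.
    by apply/measurable_EFinP; exact: measurableT_comp.
    by apply: Rintegral_ge0.
  by rewrite lte_mul_pinfty// lee_fin; apply: Rintegral_ge0.
split.
  have := integrable_fubini_F iG.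
  by apply: eq_integrable => // t _; rewrite /fubini_F inn.
have := Fubini iG.
under eq_integral do rewrite inn.
under [in X in _ = X -> _]eq_integral do rewrite inn2.
by rewrite /Rintegral => ->.
Qed.

End cosine_transform.

Section dilated_kernels.
Variables (R : realType) (n : nat).
Local Notation RT := (measurableTypeR R).
Local Notation la := (lebesgue_rV R n).

Lemma dotpDl (x y t : 'rV[R]_n) : dotp (x + y) t = dotp x t + dotp y t.
Proof. by rewrite /dotp -big_split; apply: eq_bigr => i _; rewrite mxE mulrDl. Qed.

Lemma dotpZl (c : R) (x t : 'rV[R]_n) : dotp (c *: x) t = c * dotp x t.
Proof. by rewrite /dotp mulr_sumr; apply: eq_bigr => i _; rewrite mxE mulrA. Qed.

Lemma dotpNl (x t : 'rV[R]_n) : dotp (- x) t = - dotp x t.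
Proof. by rewrite -scaleN1r dotpZl mulN1r. Qed.

Lemma dotp0l (t : 'rV[R]_n) : dotp 0 t = 0.
Proof. by rewrite -(scale0r (0 : 'rV[R]_n)) dotpZl mul0r. Qed.

Lemma dotpZr (c : R) (x t : 'rV[R]_n) : dotp t (c *: x) = c * dotp t x.
Proof. by rewrite dotpC dotpZl dotpC. Qed.

Definition damping_at (e : R) (t : 'rV[R]_n) : R := damping (e *: t).

(** The transform of damping_at e. As e tends to 0 the damping tends to 1 and
    poisson_at e is an approximate identity. *)
Definition poisson_at (e : R) (x : 'rV[R]_n) : R := e ^- n * poisson (e^-1 *: x).

Lemma measurable_scale_rV (e : R) : measurable_fun setT (fun x : 'rV[R]_n => e *: x).
Proof.
have := measurable_rV_affine e (0 : 'rV[R]_n).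
by under eq_fun do rewrite add0r.
Qed.

Lemma measurable_damping_at e : measurable_fun setT (damping_at e : _ -> RT).
Proof. by apply: (measurableT_comp (@measurable_damping R n)); exact: measurable_scale_rV. Qed.

Lemma poisson_at_ge0 e x : 0 < e -> 0 <= poisson_at e x.
Proof. by move=> e0; rewrite mulr_ge0 ?poisson_ge0// invr_ge0 exprn_ge0// ltW. Qed.

Lemma measurable_poisson_at e : measurable_fun setT (poisson_at e : _ -> RT).
Proof.
apply: measurable_funM => //.
by apply: (measurableT_comp (@measurable_poisson R n)); exact: measurable_scale_rV.
Qed.

Lemma integral_damping_at_wave e (x : 'rV[R]_n) a : 0 < e ->
  (\int[la]_t (damping_at e t * (1 + cos (2 * pi * dotp t x + a)))%:E =
   (e ^- n * 2 ^+ n + cos a * poisson_at e x)%:E)%E.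
Proof.
move=> e0; rewrite (@ge0_integral_rV_affine R n e^-1 0); last 3 first.
  by rewrite invr_gt0.
  apply/measurable_EFinP; apply: measurable_funM; first exact: measurable_damping_at.
  by apply: measurable_funD => //; apply: measurable_fun_cos; exact: measurable_phase.
  by move=> t; rewrite lee_fin mulr_ge0 ?damping_ge0 ?cosD1_ge0.
transitivity ((e^-1 ^+ n)%:E * \int[la]_t
   (damping t * (1 + cos (2 * pi * dotp t (e^-1 *: x) + a)))%:E)%E.
  congr (_ * _)%E; apply: eq_integral => t _.
  by rewrite /damping_at add0r scalerA divff ?gt_eqF// scale1r dotpZl dotpZr.
rewrite integral_damping_wave -EFinM exprVn; congr EFin.
by rewrite /poisson_at; ring.
Qed.

Lemma damping_at_ge0 e t : 0 <= damping_at e t.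
Proof. exact: damping_ge0. Qed.

Lemma integral_damping_at e : 0 < e ->
  (\int[la]_t (damping_at e t)%:E = (e ^- n * 2 ^+ n)%:E)%E.
Proof.
move=> e0; have := integral_damping_at_wave 0 (pi / 2) e0.
rewrite cos_pihalf mul0r addr0 => <-; apply: eq_integral => t _.
by rewrite (dotpC t) dotp0l mulr0 add0r cos_pihalf addr0 mulr1.
Qed.

Lemma integrable_damping_at e : 0 < e -> la.-integrable setT (EFin \o damping_at e).
Proof.
move=> e0; apply/integrableP; split.
  by apply/measurable_EFinP; exact: measurable_damping_at.
under eq_integral do rewrite /= ger0_norm ?damping_ge0//.
by rewrite integral_damping_at// ltry.
Qed.

(** Subtract the mass of the damping from integral_damping_at_wave. *)
Lemma Rintegral_damping_at_wave e (x : 'rV[R]_n) a : 0 < e ->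
  \int[la]_t (damping_at e t * cos (2 * pi * dotp t x + a)) = cos a * poisson_at e x.
Proof.
move=> e0; have := integral_damping_at_wave x a e0.
rewrite Rintegral_wave//; last 3 first.
  by move=> t; exact: damping_ge0.
  exact: integrable_damping_at.
  exact: measurable_phase.
by rewrite {1}/Rintegral integral_damping_at//= => -[] /addrI.
Qed.

Lemma cosft_damping_at e x : 0 < e -> cosft (damping_at e) x = poisson_at e x.
Proof.
move=> e0; rewrite -[RHS]mul1r -cos0 -Rintegral_damping_at_wave//.
by apply: eq_Rintegral => t _; rewrite addr0.
Qed.

Lemma cosft_damping_at_cos e x y : 0 < e ->
  cosft (fun t => damping_at e t * cos (2 * pi * dotp t x)) y =
  2^-1 * (poisson_at e (y - x) + poisson_at e (y + x)).
Proof.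
move=> e0.
have ic z : la.-integrable setT (EFin \o (fun t => damping_at e t * cos (2 * pi * dotp t z))).
  by apply: integrable_cos; exact: integrable_damping_at.
rewrite -!cosft_damping_at// /cosft -RintegralD// -RintegralZl//; last first.
  have := integrableD measurableT (ic (y - x)) (ic (y + x)).
  by apply: eq_integrable.
apply: eq_Rintegral => t _; rewrite -mulrDr.
rewrite (dotpC t (y - x)) (dotpC t (y + x)) !dotpDl dotpNl (dotpC y) (dotpC x).
rewrite (mulrBr (2 * pi)) (mulrDr (2 * pi)) cosB cosD.
move: (damping_at e t) (cos (2 * pi * dotp t x)) (cos (2 * pi * dotp t y))
  (sin (2 * pi * dotp t x)) (sin (2 * pi * dotp t y)) => A B C D E.
by field.
Qed.

(** A regularised Parseval identity: the damping makes the frequency side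
    absolutely convergent, and on the space side it becomes a convolution with
    the Poisson kernel. Cosines only see even functions, whence the kernel
    symmetrised in x. *)
Lemma pairing_damping (g h : 'rV[R]_n -> R) e : 0 < e ->
  la.-integrable setT (EFin \o g) -> la.-integrable setT (EFin \o h) ->
  la.-integrable setT (EFin \o (fun t => damping_at e t * cosft h t * cosft g t)) /\
  \int[la]_t (damping_at e t * cosft h t * cosft g t) =
  \int[la]_x (g x * \int[la]_y (h y * (2^-1 * (poisson_at e (y - x) + poisson_at e (y + x))))).
Proof.
move=> e0 ig ih; have id := integrable_damping_at e0.
have [iq _] := cosft_pairing id ih.
have [i1 ->] := cosft_pairing iq ig; split => //.
apply: eq_Rintegral => x _; congr (_ * _).
have [_ H] := cosft_pairing (integrable_cos x id) ih.
transitivity (\int[la]_t (damping_at e t * cos (2 * pi * dotp t x) * cosft h t)).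
  by apply: eq_Rintegral => t _; rewrite mulrAC.
by rewrite H; apply: eq_Rintegral => y _; rewrite cosft_damping_at_cos.
Qed.

Lemma integrable_poisson : la.-integrable setT (EFin \o @poisson R n).
Proof.
apply/integrableP; split; first by apply/measurable_EFinP; exact: measurable_poisson.
under eq_integral do rewrite /= ger0_norm ?poisson_ge0//.
by rewrite integral_poisson ltry.
Qed.

Lemma poisson_at_dilate (p : 'rV[R]_n -> R) e x : 0 < e ->
  measurable_fun setT (p : _ -> RT) -> (forall y, 0 <= p y) ->
  (\int[la]_y (p y * poisson_at e (y - x))%:E =
   \int[la]_z (p (x + e *: z) * poisson z)%:E)%E.
Proof.
move=> e0 mp p0.
have maff : measurable_fun setT (fun z : 'rV[R]_n => x + e *: z).
  exact: measurable_rV_affine.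
rewrite (@ge0_integral_rV_affine R n e x)//; last 2 first.
  apply/measurable_EFinP; apply: measurable_funM => //.
  apply: (measurableT_comp (measurable_poisson_at e)).
  have := measurable_rV_affine 1 (- x).
  by under eq_fun do rewrite scale1r addrC.
  by move=> y; rewrite lee_fin mulr_ge0// poisson_at_ge0.
rewrite -ge0_integralZl_EFin//; last 3 first.
- by move=> y _; rewrite lee_fin mulr_ge0// poisson_at_ge0.
- apply/measurable_EFinP; apply: measurable_funM; first exact: measurableT_comp.
  apply: (measurableT_comp (measurable_poisson_at e)).
  under eq_fun do rewrite addrAC subrr add0r.
  exact: measurable_scale_rV.
- by rewrite exprn_ge0// ltW.
apply: eq_integral => z _; rewrite -EFinM addrAC subrr add0r /poisson_at.
rewrite scalerA mulVf ?gt_eqF// scale1r; congr EFin.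
have en0 : e ^+ n != 0 by rewrite expf_neq0// gt_eqF.
by field.
Qed.

End dilated_kernels.

(** * Indicator functions of balls *)

Section ball_indicator.
Variable R : realType.
Local Notation mu := (@lebesgue_measure R).
Local Notation RT := (measurableTypeR R).

Definition ball_ind n (s : R) (x : 'rV[R]_n) : R := sqrt_pow 0 (s ^+ 2 - dotp x x).

Lemma ball_indE n (s : R) (x : 'rV[R]_n) : 0 <= s -> ball_ind s x = if norm2 x < s then 1 else 0.
Proof.
move=> s0; rewrite /ball_ind /sqrt_pow subr_gt0 expr0 -norm2_sqr.
by rewrite ltr_pXn2r ?nnegrE ?norm2_ge0.
Qed.

Lemma ball_ind_ge0 n s (x : 'rV[R]_n) : 0 <= ball_ind s x.
Proof. exact: sqrt_pow_ge0. Qed.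

Lemma ball_ind_le1 n s (x : 'rV[R]_n) : ball_ind s x <= 1.
Proof. by rewrite /ball_ind /sqrt_pow expr0; case: ifP. Qed.

Lemma ball_indN n s (x : 'rV[R]_n) : ball_ind s (- x) = ball_ind s x.
Proof. by rewrite /ball_ind dotpNl dotpC dotpNl opprK. Qed.

Lemma measurable_ball_ind n s : measurable_fun setT (@ball_ind n s : _ -> RT).
Proof.
apply: measurable_sqrt_pow; apply: measurable_funB => //; exact: measurable_fun_dotp.
Qed.

(** At frequency 0 and phase pi / 2 the cosine disappears from
    wave_ball_transform. *)
Lemma integral_ball_ind n (s : R) : 0 < s ->
  (\int[lebesgue_rV R n.+1]_x (ball_ind s x)%:E = (ball_coef R n.+1 * s ^+ n.+1)%:E)%E.
Proof.
move=> s0; have := wave_ball_transform (s ^+ 2) (pi / 2) (0 : 'rV[R]_n.+1).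
under eq_integral do rewrite dotpC dotp0l mulr0 add0r cos_pihalf addr0 mul1r.
rewrite /norm2 dotp0l sqrtr0.
under [X in (_ = _ * X)%E -> _]eq_integral do rewrite mulr0 mul0r add0r cos_pihalf addr0 mul1r.
rewrite slice_integral => ->; rewrite -EFinM mulrA -ball_coefS; congr (_ * _)%:E.
by rewrite /sqrt_pow exprn_gt0// sqrtr_sqr ger0_norm// ltW.
Qed.

Lemma integrable_ball_ind n (s : R) : 0 < s ->
  (lebesgue_rV R n.+1).-integrable setT (EFin \o @ball_ind n.+1 s).
Proof.
move=> s0; apply/integrableP; split.
  by apply/measurable_EFinP; exact: measurable_ball_ind.
under eq_integral do rewrite /= ger0_norm ?ball_ind_ge0//.
by rewrite integral_ball_ind// ltry.
Qed.

Lemma integrable_slice m : mu.-integrable setT (EFin \o (fun y => sqrt_pow m (1 - y ^+ 2))).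
Proof.
apply/integrableP; split; first by apply/measurable_EFinP; exact: measurable_slice.
under eq_integral do rewrite /= ger0_norm ?sqrt_pow_ge0//.
by rewrite slice_weightE ltry.
Qed.

(** With nu = (m + 1) / 2, this is k ^ (- nu) times the Bessel function of order nu
    at k, up to a constant factor (Poisson's integral). *)
Definition slice_cos m (k : R) : R := \int[mu]_y (sqrt_pow m (1 - y ^+ 2) * cos (k * y)).

Lemma cosft_ball_ind n (s : R) (t : 'rV[R]_n.+1) : 0 < s ->
  cosft (ball_ind s) t = ball_coef R n * s ^+ n.+1 * slice_cos n (s * (2 * pi * norm2 t)).
Proof.
move=> s0; have s2 : 0 < s ^+ 2 by rewrite exprn_gt0.
have := wave_ball_transform (s ^+ 2) 0 t.
under eq_integral do rewrite mulrC.
rewrite (Rintegral_wave (@ball_ind_ge0 n.+1 s) (integrable_ball_ind n s0) (measurable_phase t 0)).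
rewrite (@ge0_integral_affine R s 0)//; last 2 first.
  exact: measurable_wave_slice.
  by move=> y; rewrite lee_fin mulr_ge0 ?cosD1_ge0 ?sqrt_pow_ge0.
have E y : (1 + cos (2 * pi * norm2 t * (0 + s * y) + 0)) * sqrt_pow n (s ^+ 2 - (0 + s * y) ^+ 2) =
    s ^+ n * (sqrt_pow n (1 - y ^+ 2) * (1 + cos (s * (2 * pi * norm2 t) * y))).
  rewrite (_ : s ^+ 2 - _ = s ^+ 2 * (1 - y ^+ 2)); last by rewrite add0r exprMn mulrBr mulr1.
  rewrite sqrt_pow_scale// sqrtr_sqr ger0_norm ?ltW// add0r addr0.
  rewrite [LHS]mulrC -[LHS]mulrA; congr (_ * (_ * (1 + cos _))).
  by rewrite mulrCA mulrA.
under [in X in _ = X -> _]eq_integral do rewrite E EFinM.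
have mph : measurable_fun setT (fun y : RT => s * (2 * pi * norm2 t) * y : RT).
  exact: measurable_funM.
rewrite ge0_integralZl_EFin//; last 3 first.
- by move=> y _; rewrite lee_fin mulr_ge0 ?cosD1_ge0 ?sqrt_pow_ge0.
- apply/measurable_EFinP; apply: measurable_funM; first exact: measurable_slice.
  by apply: measurable_funD => //; exact: measurable_fun_cos.
- by rewrite exprn_ge0// ltW.
rewrite (Rintegral_wave _ (integrable_slice n) mph); last by move=> y; exact: sqrt_pow_ge0.
rewrite -!EFinM => -[].
rewrite {1}/Rintegral integral_ball_ind//= -/(slice_weight R n) ball_coefS.
rewrite -/(slice_cos n _).
under eq_Rintegral do rewrite addr0.
rewrite -/(cosft (ball_ind s) t) => H.
apply: (@addrI _ (ball_coef R n * slice_weight R n * s ^+ n.+1)).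
by rewrite H exprS; ring.
Qed.

Lemma slice_cos0 m : slice_cos m 0 = slice_weight R m.
Proof. by apply: eq_Rintegral => y _; rewrite mul0r cos0 mulr1. Qed.

End ball_indicator.

Section dominated_Rintegral.
Context d (T : measurableType d) (R : realType).
Variable mu : {measure set T -> \bar R}.
Local Notation RT := (measurableTypeR R).

Lemma cvg_Rintegral_dominated (f_ : nat -> T -> R) (f g : T -> R) (N : set T) :
  (forall k, measurable_fun setT (f_ k : T -> RT)) ->
  measurable_fun setT (f : T -> RT) ->
  measurable N -> mu N = 0%E ->
  (forall x, ~ N x -> f_ ^~ x @ \oo --> f x) ->
  mu.-integrable setT (EFin \o g) -> (forall k x, `|f_ k x| <= g x) ->
  (\int[mu]_x f_ k x) @[k --> \oo] --> \int[mu]_x f x.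
Proof.
move=> mf_ mf mN N0 cf ig fg.
have [|||||if_ _] := @dominated_convergence _ _ _ mu setT measurableT
  (fun k => EFin \o f_ k) (EFin \o f) (EFin \o g).
- by move=> k; apply/measurable_EFinP; exact: mf_.
- by apply/measurable_EFinP; exact: mf.
- exists N; split => // x /= H; apply: contrapT => Nx; apply: H => _.
  by apply: cvg_EFin; [exact: nearW|exact: cf].
- exact: ig.
- by apply: aeW => x k _; rewrite lee_fin.
move=> h; apply: fine_cvg; rewrite /Rintegral fineK//.
exact: integrable_fin_num.
Qed.

End dominated_Rintegral.

Section smoothing.
Variables (R : realType) (n : nat).
Local Notation RT := (measurableTypeR R).
Local Notation la := (lebesgue_rV R n.+1).
Local Notation V := 'rV[R]_n.+1.

(** The convolution of the indicator function of a ball with poisson_at e,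
    written in the rescaled variable z. *)
Definition smooth_ball (e s : R) (x : V) : R :=
  \int[la]_z (poisson z * ball_ind s (x + e *: z)).

Lemma measurable_ball_ind_affine e s (x : V) :
  measurable_fun setT (fun z : V => ball_ind s (x + e *: z) : RT).
Proof. by apply: (measurableT_comp (@measurable_ball_ind R n.+1 s)); exact: measurable_rV_affine. Qed.

Lemma normr_ball_ind_le1 s (x : V) : `|ball_ind s x| <= 1.
Proof. by rewrite ger0_norm ?ball_ind_ge0// ball_ind_le1. Qed.

Lemma integrable_smooth_ball e s (x : V) :
  la.-integrable setT (EFin \o (fun z => poisson z * ball_ind s (x + e *: z))).
Proof.
apply: (@integrable_mul_bounded _ _ _ _ _ _ 1).
- exact: integrable_poisson.
- exact: measurable_ball_ind_affine.
- by move=> z; exact: normr_ball_ind_le1.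
Qed.

Lemma Rintegral_poisson : \int[la]_z poisson z = 1.
Proof. by rewrite /Rintegral integral_poisson. Qed.

Lemma smooth_ball_ge0 e s x : 0 <= smooth_ball e s x.
Proof. by apply: Rintegral_ge0 => z _; rewrite mulr_ge0 ?poisson_ge0 ?ball_ind_ge0. Qed.

Lemma smooth_ball_le1 e s x : smooth_ball e s x <= 1.
Proof.
rewrite -Rintegral_poisson; apply: le_Rintegral => //.
- exact: integrable_smooth_ball.
- exact: integrable_poisson.
- by move=> z _; rewrite ler_piMr ?poisson_ge0 ?ball_ind_le1.
Qed.

Lemma integral_ball_poisson_at e s (x : V) : 0 < e ->
  (\int[la]_y (ball_ind s y * poisson_at e (y - x))%:E = (smooth_ball e s x)%:E)%E.
Proof.
move=> e0; rewrite poisson_at_dilate//; last 2 first.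
  exact: measurable_ball_ind.
  by move=> y; exact: ball_ind_ge0.
rewrite /smooth_ball /Rintegral fineK; first by apply: eq_integral => z _; rewrite mulrC.
by apply: integrable_fin_num => //; exact: integrable_smooth_ball.
Qed.

Lemma integrable_ball_poisson_at e s (x : V) : 0 < e ->
  la.-integrable setT (EFin \o (fun y => ball_ind s y * poisson_at e (y - x))).
Proof.
move=> e0; apply/integrableP; split.
  apply/measurable_EFinP; apply: measurable_funM; first exact: measurable_ball_ind.
  apply: (measurableT_comp (measurable_poisson_at e)).
  have := measurable_rV_affine 1 (- x).
  by under eq_fun do rewrite scale1r addrC.
have p0 y : 0 <= ball_ind s y * poisson_at e (y - x).
  by apply: mulr_ge0; [exact: ball_ind_ge0|exact: poisson_at_ge0].
under eq_integral do rewrite /= (ger0_norm (p0 _)).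
by rewrite integral_ball_poisson_at// ltry.
Qed.

Lemma ball_pairing_kernel e s (x : V) : 0 < e ->
  \int[la]_y (ball_ind s y * (2^-1 * (poisson_at e (y - x) + poisson_at e (y + x)))) =
  2^-1 * (smooth_ball e s x + smooth_ball e s (- x)).
Proof.
move=> e0; have i1 := integrable_ball_poisson_at s x e0.
have i2 := integrable_ball_poisson_at s (- x) e0.
have E z : \int[la]_y (ball_ind s y * poisson_at e (y - z)) = smooth_ball e s z.
  by rewrite /Rintegral integral_ball_poisson_at.
rewrite -!E -(RintegralD measurableT i1 i2).
rewrite -(RintegralZl _ measurableT (integrableD measurableT i1 i2)).
by apply: eq_Rintegral => y _; rewrite opprK mulrCA mulrDr.
Qed.

(** The indicator function is locally constant away from the sphere. *)
Lemma cvg_ball_ind (s : R) (x z : V) : dotp x x != s ^+ 2 ->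
  ball_ind s (x + k.+1%:R^-1 *: z) @[k --> \oo] --> ball_ind s x.
Proof.
move=> xs; pose u (k : nat) : R := s ^+ 2 - dotp (x + k.+1%:R^-1 *: z) (x + k.+1%:R^-1 *: z).
have hE k : k.+1%:R^-1 = harmonic k :> R by [].
have cu : u k @[k --> \oo] --> s ^+ 2 - dotp x x.
  rewrite (_ : u = fun k => s ^+ 2 - (dotp x x + (harmonic k * (2 * dotp x z) +
      harmonic k * harmonic k * dotp z z))); last first.
    apply/funext => k; rewrite /u hE dotpDl [dotp x _]dotpC dotpDl [dotp _ (_ + _)]dotpC dotpDl.
    by rewrite !dotpZl !dotpZr (dotpC z x); ring.
  apply: cvgB; first exact: cvg_cst.
  rewrite -[X in _ --> X]addr0; apply: cvgD; first exact: cvg_cst.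
  rewrite -[X in _ --> X]addr0; apply: cvgD.
    rewrite -[X in _ --> X](mul0r (2 * dotp x z)).
    by apply: cvgM; [exact: cvg_harmonic|exact: cvg_cst].
  rewrite -[X in _ --> X](mul0r (dotp z z)); apply: cvgM; last exact: cvg_cst.
  by rewrite -[X in _ --> X](mul0r 0); apply: cvgM; exact: cvg_harmonic.
apply: (@cvg_trans _ ((fun=> ball_ind s x) @ \oo)); last exact: cvg_cst.
apply: near_eq_cvg.
rewrite /ball_ind -/(u _).
have [u0|u0] := ltP 0 (s ^+ 2 - dotp x x).
  near=> k; rewrite /sqrt_pow u0 !expr0.
  suff -> : 0 < u k by [].
  by near: k; exact: (cvgr_gt _ cu).
have {}u0 : s ^+ 2 - dotp x x < 0 by rewrite lt_neqAle u0 andbT subr_eq0 eq_sym.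
near=> k; rewrite /sqrt_pow ltNge (ltW u0)/=.
suff -> : (0 < u k) = false by [].
apply/negbTE; rewrite -leNgt; apply: ltW.
by near: k; exact: (cvgr_lt _ cu).
Unshelve. all: by end_near. Qed.

Lemma cvg_smooth_ball (s : R) (x : V) : dotp x x != s ^+ 2 ->
  smooth_ball k.+1%:R^-1 s x @[k --> \oo] --> ball_ind s x.
Proof.
move=> xs.
have -> : ball_ind s x = \int[la]_z (poisson z * ball_ind s x).
  by rewrite RintegralZr ?Rintegral_poisson ?mul1r//; exact: integrable_poisson.
apply: (@cvg_Rintegral_dominated _ _ _ _ _ _ (@poisson R n.+1) set0) => //.
- move=> k; apply: measurable_funM; first exact: measurable_poisson.
  exact: measurable_ball_ind_affine.
- by apply: measurable_funM => //; exact: measurable_poisson.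
- by move=> z _; apply: cvgM; [exact: cvg_cst|exact: cvg_ball_ind].
- exact: integrable_poisson.
- by move=> k z; rewrite normrM (ger0_norm (poisson_ge0 z)) ler_piMr ?poisson_ge0 ?normr_ball_ind_le1.
Qed.

(** The sphere of radius s lies between the balls of radii s and t for each
    t > s, and the difference of their volumes tends to 0 as t tends to s. *)
Lemma sphere_null (s : R) : 0 < s -> la [set x : V | dotp x x = s ^+ 2] = 0%E.
Proof.
move=> s0; set S := [set x | _].
have mS : measurable S.
  rewrite (_ : S = (fun x : V => dotp x x) @^-1` [set s ^+ 2])//.
  rewrite -[X in measurable X]setTI; apply: (@measurable_fun_dotp R n.+1 _ V id id) => //.
set c := ball_coef R n.+1.
have bound (t : R) : s < t -> (la S <= (c * t ^+ n.+1 - c * s ^+ n.+1)%:E)%E.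
  move=> st; rewrite EFinB lee_suber_addr//.
  rewrite -!integral_ball_ind//; last exact: lt_trans st.
  rewrite -[S in la S]setIT -integral_indic// -ge0_integralD//; last 3 first.
  - by apply/measurable_EFinP; exact: measurable_indic.
  - by move=> x _; rewrite lee_fin ball_ind_ge0.
  - by apply/measurable_EFinP; exact: measurable_ball_ind.
  apply: ge0_le_integral => //.
  - by move=> x _; rewrite adde_ge0// lee_fin ball_ind_ge0.
  - apply: emeasurable_funD; apply/measurable_EFinP; first exact: measurable_indic.
    exact: measurable_ball_ind.
  - by apply/measurable_EFinP; exact: measurable_ball_ind.
  - have t0 := lt_trans s0 st.
    move=> x _; rewrite indicE (ball_indE _ (ltW s0)) (ball_indE _ (ltW t0)).
    have nE : S x -> norm2 x = s by move=> xs; rewrite /norm2 xs sqrtr_sqr ger0_norm// ltW.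
    rewrite -EFinD lee_fin; have [/set_mem/nE ->|_] := boolP (x \in S).
      by rewrite ltxx st addr0.
    by rewrite add0r; case: ifPn => [xs|_]; [rewrite (lt_trans xs st)|case: ifP].
have fin : (la S)%E \is a fin_num.
  rewrite ge0_fin_numE//; apply: (le_lt_trans (bound (s + 1) _)); first by rewrite ltrDl.
  exact: ltry.
rewrite -(fineK fin); congr EFin; apply/eqP; rewrite eq_le fine_ge0// andbT.
have : (fun t => c * t ^+ n.+1 - c * s ^+ n.+1) @ s^'+ --> c * s ^+ n.+1 - c * s ^+ n.+1.
  apply: cvg_at_right_filter; apply: cvgB; last exact: cvg_cst.
  by apply: cvgM; [exact: cvg_cst|exact: exprn_continuous].
rewrite subrr => /cvgr_to_ge; apply.
near=> t; rewrite -lee_fin fineK//; apply: bound.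
by near: t; exact: nbhs_right_gt.
Unshelve. all: by end_near. Qed.

End smoothing.

Section ball_transform_bounds.
Variables (R : realType) (n : nat).
Local Notation RT := (measurableTypeR R).
Local Notation la := (lebesgue_rV R n.+1).
Local Notation V := 'rV[R]_n.+1.

Lemma Rintegral_ball_ind (s : R) : 0 < s ->
  \int[la]_x ball_ind s x = ball_coef R n.+1 * s ^+ n.+1.
Proof. by move=> s0; rewrite /Rintegral integral_ball_ind. Qed.

Lemma coord_le_norm2 (x : V) i : `|x ord0 i| <= norm2 x.
Proof.
rewrite -sqrtr_sqr; apply: ler_wsqrtr; rewrite /dotp (bigD1 i)//= -expr2 lerDl.
by apply: sumr_ge0 => j _; rewrite -expr2 sqr_ge0.
Qed.

Lemma damping_at_ge (e r : R) (t : V) : 0 < e -> norm2 t <= r ->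
  expR (- (e * r)) ^+ n.+1 <= damping_at e t.
Proof.
move=> e0 tr; rewrite -[n.+1 in X in X <= _]card_ord -prodr_const.
apply: ler_prod => i _; rewrite expR_ge0/= ler_expR lerN2 mxE normrM (gtr0_norm e0).
by rewrite ler_pM2l// (le_trans (coord_le_norm2 t i)).
Qed.

Lemma measurable_smooth_ball (e s : R) :
  measurable_fun setT (smooth_ball e s : V -> RT).
Proof.
pose G (p : V * V) := (poisson p.2 * ball_ind s (p.1 + e *: p.2))%:E.
have mG : measurable_fun setT G.
  apply/measurable_EFinP; apply: measurable_funM.
    by apply: (measurableT_comp (@measurable_poisson R n.+1)).
  apply: (measurableT_comp (@measurable_ball_ind R n.+1 s)).
  apply: measurable_fun_rV => i; under eq_fun do rewrite !mxE.
  have mc := @measurable_coord R n.+1 i.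
  apply: measurable_funD; first exact: (measurableT_comp mc).
  by apply: measurable_funM => //; exact: (measurableT_comp mc).
have G0 p : (0 <= G p)%E by rewrite lee_fin mulr_ge0 ?poisson_ge0 ?ball_ind_ge0.
have mF := @measurable_fun_fubini_tonelli_F _ _ _ _ R la G mG G0.
apply: (eq_measurable_fun (fine \o (fun x => \int[la]_z G (x, z))%E)) => //.
by apply: measurableT_comp => //; exact: fine_measurable.
Qed.

(** Cosine transforms produce the convolution in this symmetrised form. *)
Definition smooth_ball_even (e s : R) (x : V) : R :=
  2^-1 * (smooth_ball e s x + smooth_ball e s (- x)).

Lemma smooth_ball_even_ge0 e s x : 0 <= smooth_ball_even e s x.
Proof. by apply: mulr_ge0; [|apply: addr_ge0; exact: smooth_ball_ge0]. Qed.

Lemma smooth_ball_even_le1 e s x : smooth_ball_even e s x <= 1.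
Proof.
have h1 := smooth_ball_le1 e s x; have h2 := smooth_ball_le1 e s (- x).
by rewrite /smooth_ball_even; move: h1 h2; set u := smooth_ball _ _ _; set v := smooth_ball _ _ _; lra.
Qed.

Lemma normr_smooth_ball_even e s x : `|smooth_ball_even e s x| <= 1.
Proof. by rewrite (ger0_norm (smooth_ball_even_ge0 e s x)) smooth_ball_even_le1. Qed.

Lemma measurable_smooth_ball_even (e s : R) :
  measurable_fun setT (smooth_ball_even e s : V -> RT).
Proof.
have mN : measurable_fun setT (fun x : V => - x).
  have := measurable_rV_affine (-1) (0 : V).
  by under eq_fun do rewrite add0r scaleN1r.
have m1 := measurable_smooth_ball e s.
apply: measurable_funM; first exact: measurable_cst.
by apply: (measurable_funD m1); exact: (measurableT_comp m1 mN).
Qed.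

Lemma cvg_smooth_ball_even (s : R) (x : V) : dotp x x != s ^+ 2 ->
  smooth_ball_even k.+1%:R^-1 s x @[k --> \oo] --> ball_ind s x.
Proof.
move=> xs; have c1 := cvg_smooth_ball xs.
have xs' : dotp (- x) (- x) != s ^+ 2 by rewrite dotpNl dotpC dotpNl opprK.
have c2 := cvg_smooth_ball xs'; rewrite ball_indN in c2.
rewrite (_ : ball_ind s x = 2^-1 * (ball_ind s x + ball_ind s x)); last by field.
rewrite /smooth_ball_even; apply: cvgM; first exact: cvg_cst.
exact: (cvgD c1 c2).
Qed.

Lemma pairing_ball (g : V -> R) (e s : R) : 0 < e -> 0 < s ->
  la.-integrable setT (EFin \o g) ->
  la.-integrable setT (EFin \o (fun t =>
    damping_at e t * cosft (ball_ind s) t * cosft g t)) /\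
  \int[la]_t (damping_at e t * cosft (ball_ind s) t * cosft g t) =
  \int[la]_x (g x * smooth_ball_even e s x).
Proof.
move=> e0 s0 ig; have [i1 ->] := pairing_damping e0 ig (integrable_ball_ind n s0).
by split => //; apply: eq_Rintegral => x _; rewrite ball_pairing_kernel.
Qed.

(** Half of Plancherel's theorem for the ball: the damped energy of the transform
    is the integral of a function bounded by the indicator itself, since
    smoothing does not raise the maximum. *)
Lemma ball_bessel (e s : R) : 0 < e -> 0 < s ->
  \int[la]_t (damping_at e t * cosft (ball_ind s) t * cosft (ball_ind s) t) <=
  ball_coef R n.+1 * s ^+ n.+1.
Proof.
move=> e0 s0; have ib := integrable_ball_ind n s0.
have [_ ->] := pairing_ball e0 s0 ib.
rewrite -(Rintegral_ball_ind s0); apply: le_Rintegral => //.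
  apply: (integrable_mul_bounded ib (measurable_smooth_ball_even e s)).
  exact: normr_smooth_ball_even.
move=> x _; apply: ler_piMr; first exact: ball_ind_ge0.
exact: smooth_ball_even_le1.
Qed.

(** Keep only the frequencies of norm less than r in ball_bessel: the squared
    transform is at least c ^+ 2 there. Then let the damping tend to 1. *)
Lemma ball_transform_decay (c r : R) : 0 < r -> 0 <= c ->
  (forall t : V, norm2 t < r -> c <= cosft (ball_ind 1) t) ->
  c ^+ 2 * (ball_coef R n.+1 * r ^+ n.+1) <= ball_coef R n.+1.
Proof.
move=> r0 c0 hc; set B := ball_coef R n.+1.
have B0 : 0 <= B by exact: ball_coef_ge0.
have key e : 0 < e -> expR (- (e * r)) ^+ n.+1 * (c ^+ 2 * (B * r ^+ n.+1)) <= B.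
  move=> e0; have ib := integrable_ball_ind n (@ltr01 R).
  have := ball_bessel e0 ltr01; rewrite expr1n mulr1; apply: le_trans.
  rewrite mulrA -(Rintegral_ball_ind r0) -RintegralZl//; last exact: integrable_ball_ind.
  have [ip _] := pairing_ball e0 ltr01 ib.
  apply: le_Rintegral => //.
    exact: (integrableZl measurableT _ (integrable_ball_ind n r0)).
  move=> t _; rewrite (ball_indE _ (ltW r0)); case: ifPn => [tr|_].
    rewrite mulr1 -mulrA; apply: ler_pM.
    - by rewrite exprn_ge0// expR_ge0.
    - by rewrite exprn_ge0.
    - by apply: damping_at_ge => //; exact: ltW.
    - by rewrite expr2; apply: ler_pM => //; exact: hc.
  by rewrite mulr0 -mulrA mulr_ge0 ?damping_at_ge0// -expr2 sqr_ge0.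
pose F (e : R) := expR (- (e * r) * n.+1%:R) * (c ^+ 2 * (B * r ^+ n.+1)).
have cF : {for 0, continuous F} by apply: derivable_continuous; exact: ex_derive.
have : F @ 0^'+ --> F 0 by exact: cvg_at_right_filter.
rewrite {2}/F mul0r oppr0 mul0r expR0 mul1r => /cvgr_to_le; apply.
by near=> e; rewrite /F expRM_natr; apply: key; near: e; exact: nbhs_right_gt.
Unshelve. all: by end_near. Qed.

End ball_transform_bounds.

(** * Weak duality *)

Section duality.
Variables (R : realType) (n : nat).
Local Notation RT := (measurableTypeR R).
Local Notation la := (lebesgue_rV R n.+1).
Local Notation V := 'rV[R]_n.+1.

Lemma continuous_bounded_ball (f : V -> R) (r : R) : continuous f ->
  exists2 C, 0 <= C & forall x, norm2 x < r -> `|f x| <= C.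
Proof.
move=> cf; pose K := [set x : V | forall i, `[- r, r]%classic (x ord0 i)].
have cK : compact K.
  by apply: (@rV_compact R n.+1 (fun=> `[- r, r]%classic)) => i; exact: segment_compact.
have : compact (f @` K).
  exact: (@continuous_compact V R f K (continuous_subspaceT cf) cK).
move/compact_bounded => [M [_ hM]].
exists (`|M| + 1) => [|x xr]; first by rewrite addr_ge0.
apply: (hM (`|M| + 1)); first by rewrite (le_lt_trans (ler_norm M))// ltrDl.
exists x => // i; rewrite /= in_itv/= -ler_norml.
by rewrite (le_trans (coord_le_norm2 x i))// ltW.
Qed.

(** Since f is nonpositive outside the ball of radius r, it is bounded above by
    its positive part p inside the ball. By compactness p is bounded, so dominated
    convergence applies to its Poisson averages, which tend to p 0 = f 0. *)
Lemma cvg_poisson_peak (f : V -> R) (r : R) : continuous f -> 0 < r -> 0 < f 0 ->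
  la.-integrable setT (EFin \o f) ->
  (forall x, r <= norm2 x -> f x <= 0) ->
  exists2 U : nat -> R, U @ \oo --> f 0 &
    forall k, \int[la]_x (f x * poisson_at k.+1%:R^-1 x) <= U k.
Proof.
move=> cf r0 f0 intf fneg.
have mf : measurable_fun setT (f : V -> RT) by apply/measurable_EFinP; exact: measurable_int intf.
have [C C0 fC] := continuous_bounded_ball r cf.
pose p (x : V) := Num.max (f x) 0 * ball_ind r x.
have mp : measurable_fun setT (p : V -> RT).
  by apply: measurable_funM; [exact: measurable_maxr|exact: measurable_ball_ind].
have p0 x : 0 <= p x by rewrite mulr_ge0 ?ball_ind_ge0// le_max lexx orbT.
have pC x : `|p x| <= C.
  rewrite ger0_norm// /p (ball_indE _ (ltW r0)); case: ifPn => [xr|_]; last by rewrite mulr0.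
  by rewrite mulr1 ge_max C0 andbT (le_trans (ler_norm _))// fC.
have fp x : f x <= p x.
  rewrite /p (ball_indE _ (ltW r0)); case: ifPn => [xr|].
    by rewrite mulr1 le_max lexx.
  by rewrite mulr0 -leNgt; exact: fneg.
have ip e : la.-integrable setT (EFin \o (fun z => poisson z * p (e *: z))).
  apply: (@integrable_mul_bounded _ _ _ _ _ _ C) => //.
    exact: integrable_poisson.
  by apply: (measurableT_comp mp); exact: measurable_scale_rV.
exists (fun k => \int[la]_z (poisson z * p (k.+1%:R^-1 *: z))).
  have -> : f 0 = \int[la]_z (poisson z * f 0).
    by rewrite RintegralZr ?Rintegral_poisson ?mul1r//; exact: integrable_poisson.
  apply: (@cvg_Rintegral_dominated _ _ _ _ _ _ (fun z => poisson z * C) set0) => //.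
  - move=> k; apply: measurable_funM; first exact: measurable_poisson.
    by apply: (measurableT_comp mp); exact: measurable_scale_rV.
  - by apply: measurable_funM => //; exact: measurable_poisson.
  - move=> z _; apply: cvgM; first exact: cvg_cst.
    have cz : (k.+1%:R^-1 *: z) @[k --> \oo] --> (0 : V).
      by rewrite -(scale0r z); apply: cvgZr_tmp; exact: cvg_harmonic.
    have p00 : p 0 = f 0.
      by rewrite /p (ball_indE _ (ltW r0)) /norm2 dotp0l sqrtr0 r0 mulr1; apply/max_idPl/ltW.
    rewrite -p00; apply: cvgM.
      apply: (@cvg_comp _ _ _ _ (fun x => Num.max (f x) 0) _ _ _ cz).
      apply: (@continuous_max _ _ (f) (cst 0)); [exact: cf|exact: cst_continuous].
    have h0 : dotp (0 : V) 0 != r ^+ 2 by rewrite dotp0l eq_sym sqrf_eq0 gt_eqF.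
    by have := cvg_ball_ind z h0; under eq_fun do rewrite add0r.
  - have := integrableZr measurableT C (integrable_poisson R n.+1).
    by apply: eq_integrable.
  - by move=> k z; rewrite normrM (ger0_norm (poisson_ge0 z)) ler_wpM2l ?poisson_ge0.
move=> k; set e := k.+1%:R^-1; have e0 : 0 < e :> R by rewrite invr_gt0 ltr0n.
have := @poisson_at_dilate R n.+1 p e 0 e0 mp p0.
under eq_integral do rewrite subr0.
under [in X in _ = X -> _]eq_integral do rewrite add0r mulrC.
move=> E.
have ipp : la.-integrable setT (EFin \o (fun x => p x * poisson_at e x)).
  apply/integrableP; split.
    by apply/measurable_EFinP; apply: measurable_funM => //; exact: measurable_poisson_at.
  have pp y : 0 <= p y * poisson_at e y by rewrite mulr_ge0// poisson_at_ge0.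
  under eq_integral do rewrite /= (ger0_norm (pp _)).
  by rewrite E; have [_] := integrableP _ _ _ (ip e); apply: le_lt_trans; apply: ge0_le_integral => //;
    [move=> z _; rewrite lee_fin mulr_ge0 ?poisson_ge0|exact: measurable_int (ip e)|
     apply: measurableT_comp => //; exact: measurable_int (ip e)|move=> z _; rewrite lee_fin ler_norm].
rewrite [leRHS](_ : _ = \int[la]_x (p x * poisson_at e x)); last by rewrite /Rintegral E.
apply: le_Rintegral => //.
  have [ik _] := cosft_pairing intf (integrable_damping_at n.+1 e0).
  by move: ik; apply: eq_integrable => // x _; rewrite /= cosft_damping_at.
by move=> x _; rewrite ler_wpM2r// poisson_at_ge0.
Qed.

(** Integrate the pointwise bound against the transform of f, which is
    nonnegative, with the damping as a regulariser. By pairing_damping the left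
    side becomes an integral of f against smoothed balls, which converges by
    dominated convergence because spheres are null sets; the right side becomes
    M times a Poisson average of f, whose limit is at most M * f 0. *)
Lemma ball_duality (f : V -> R) (r s a b M : R) : 0 < r -> 0 < s -> 0 <= M ->
  continuous f -> la.-integrable setT (EFin \o f) -> 0 < f 0 ->
  (forall x, r <= norm2 x -> f x <= 0) -> (forall t, 0 <= cosft f t) ->
  (forall t : V, a * cosft (ball_ind r) t - b * cosft (ball_ind s) t <= M) ->
  a * \int[la]_x (f x * ball_ind r x) - b * \int[la]_x (f x * ball_ind s x) <= M * f 0.
Proof.
move=> r0 s0 M0 cf intf f0 fneg ft hM.
have mf : measurable_fun setT (f : V -> RT) by apply/measurable_EFinP; exact: measurable_int intf.
have [U cU fU] := cvg_poisson_peak cf r0 f0 intf fneg.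
have lim q : 0 < q -> (\int[la]_x (f x * smooth_ball_even k.+1%:R^-1 q x))
    @[k --> \oo] --> \int[la]_x (f x * ball_ind q x).
  move=> q0; apply: (@cvg_Rintegral_dominated _ _ _ _ _ _ (fun x => `|f x|) [set x : V | dotp x x = q ^+ 2]).
  - by move=> k; apply: measurable_funM => //; exact: measurable_smooth_ball_even.
  - by apply: measurable_funM => //; exact: measurable_ball_ind.
  - rewrite (_ : mkset _ = (fun x : V => dotp x x) @^-1` [set q ^+ 2])//.
    by rewrite -[X in measurable X]setTI; apply: (@measurable_fun_dotp R n.+1 _ V id id).
  - exact: sphere_null.
  - by move=> x /eqP xq; apply: cvgM; [exact: cvg_cst|exact: cvg_smooth_ball_even].
  - exact: integrable_norm intf.
  - by move=> k x; rewrite normrM ler_piMr// normr_smooth_ball_even.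
pose L k := a * \int[la]_x (f x * smooth_ball_even k.+1%:R^-1 r x) -
  b * \int[la]_x (f x * smooth_ball_even k.+1%:R^-1 s x).
have cl : L k @[k --> \oo] -->
    a * \int[la]_x (f x * ball_ind r x) - b * \int[la]_x (f x * ball_ind s x).
  by apply: cvgB; (apply: cvgM; [exact: cvg_cst|exact: lim]).
have cr : (M * U k) @[k --> \oo] --> M * f 0 by apply: cvgM; [exact: cvg_cst|].
apply: (ler_cvg_to cl cr); apply: nearW => k; rewrite /L.
set e := k.+1%:R^-1; have e0 : 0 < e :> R by rewrite invr_gt0 ltr0n.
have [i1 <-] := pairing_ball e0 r0 intf; have [i2 <-] := pairing_ball e0 s0 intf.
apply: (@le_trans _ _ (M * \int[la]_x (f x * poisson_at e x))); last by rewrite ler_wpM2l// fU.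
have [i3 E3] := cosft_pairing (integrable_damping_at n.+1 e0) intf.
under [X in _ <= M * X]eq_Rintegral do rewrite -cosft_damping_at//.
rewrite -E3 -!RintegralZl//.
have i1' := integrableZl measurableT a i1; have i2' := integrableZl measurableT b i2.
have i3' := integrableZl measurableT M i3.
rewrite -RintegralB//; apply: le_Rintegral => //; first exact: (integrableB measurableT i1' i2').
move=> t _; have d0 := damping_at_ge0 e t.
rewrite [leRHS](_ : _ = (damping_at e t * cosft f t) * M); last by ring.
rewrite [leLHS](_ : _ = (damping_at e t * cosft f t) *
  (a * cosft (ball_ind r) t - b * cosft (ball_ind s) t)); last by ring.
by apply: ler_wpM2l; [rewrite mulr_ge0|].
Qed.

End duality.

(** * Differential relations between slice integrals *)

Section slice_integrals.
Variable R : realType.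
Local Notation mu := (@lebesgue_measure R).
Local Notation RT := (measurableTypeR R).

Lemma sqr_lt1 (y : R) : (y ^+ 2 < 1) = (`|y| < 1).
Proof.
by rewrite -real_normK ?num_real// -[X in _ < X](expr1n R 2) ltr_pXn2r ?nnegrE.
Qed.

Lemma sqrt_pow_support m (y : R) : 1 < `|y| -> sqrt_pow m (1 - y ^+ 2) = 0.
Proof.
move=> y1; rewrite /sqrt_pow subr_gt0; case: ifPn => // h.
by move: h; rewrite sqr_lt1 ltNge (ltW y1).
Qed.

Lemma sqrt_pow_mulr m (u : R) : sqrt_pow m u * u = sqrt_pow m.+2 u.
Proof.
rewrite /sqrt_pow; case: ifPn => u0; last by rewrite mul0r.
by rewrite -addn2 exprD sqr_sqrtr// ltW.
Qed.

Definition slice_sin m (k : R) : R := \int[mu]_y (sqrt_pow m (1 - y ^+ 2) * (y * sin (k * y))).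

Lemma integrable_slice_mul m (h : R -> R) : continuous h ->
  (forall y, `|y| <= 1 -> `|h y| <= 1) ->
  mu.-integrable setT (EFin \o (fun y => sqrt_pow m (1 - y ^+ 2) * h y)).
Proof.
move=> ch h1.
have mh : measurable_fun setT (h : RT -> RT) by exact: continuous_measurable_fun.
apply: (le_integrable _ _ _ (integrable_slice R m)) => //.
  by apply/measurable_EFinP; apply: measurable_funM => //; exact: measurable_slice.
move=> y _ /=; rewrite lee_fin normrM; have [y1|y1] := leP `|y| 1.
  by rewrite ler_piMr// h1.
by rewrite sqrt_pow_support// normr0 mul0r.
Qed.

Lemma derivable_slice_cos m (k : R) : is_derive k 1 (slice_cos m) (- slice_sin m k).
Proof.
pose f (x y : R) := sqrt_pow m (1 - y ^+ 2) * cos (x * y).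
have df (x y : R) : is_derive x 1 (f ^~ y) (sqrt_pow m (1 - y ^+ 2) * (y * - sin (x * y))).
  by rewrite /f; apply: is_derive_eq; rewrite /GRing.scale/=; ring.
have d1f (x y : R) : (partial1of2 f) x y = sqrt_pow m (1 - y ^+ 2) * (y * - sin (x * y)).
  by rewrite partial1of2E; case: (df x y).
have kI : `]k - 1, k + 1[%classic k by rewrite /= in_itv/= ltrBlDr ltrDl ltr01.
have intf (x : R) : `]k - 1, k + 1[%classic x -> mu.-integrable setT (EFin \o f x).
  move=> _; apply: integrable_slice_mul => [|y _]; last exact: normr_cos_le1.
  by move=> y; apply: derivable_continuous; exact: ex_derive.
have derf (x y : R) : `]k - 1, k + 1[%classic x -> [set: R] y -> derivable (f ^~ y) x 1.
  by move=> _ _; case: (df x y).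
have Gub (x y : R) : `]k - 1, k + 1[%classic x -> [set: R] y ->
    `|(partial1of2 f) x y| <= sqrt_pow m (1 - y ^+ 2).
  move=> _ _; rewrite d1f normrM (ger0_norm (sqrt_pow_ge0 _ _)).
  have [y1|y1] := leP `|y| 1; last by rewrite sqrt_pow_support// mul0r.
  rewrite ler_piMr ?sqrt_pow_ge0// normrM normrN mulr_ile1//.
  by rewrite ler_norml sin_geN1 sin_le1.
have D := derivable_under_integral measurableT kI intf derf
  (fun y => sqrt_pow_ge0 m _) (integrable_slice R m) Gub.
have E := differentiation_under_integral measurableT kI intf derf
  (fun y => sqrt_pow_ge0 m _) (integrable_slice R m) Gub.
apply: DeriveDef => //; rewrite -derive1E E.
rewrite /slice_sin -[RHS]mulN1r -RintegralZl//.
  by apply: eq_Rintegral => y _; rewrite d1f; ring.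
apply: integrable_slice_mul => [y|y y1].
  by apply: derivable_continuous; exact: ex_derive.
by rewrite normrM mulr_ile1// ler_norml sin_geN1 sin_le1.
Qed.

Lemma continuous_sqrt_slice : continuous (fun y : R => Num.sqrt (1 - y ^+ 2)).
Proof.
have c1 (y : R) : {for y, continuous (fun z : R => 1 - z ^+ 2)}.
  by apply: derivable_continuous; exact: ex_derive.
have : continuous (Num.sqrt \o (fun z : R => 1 - z ^+ 2)).
  by move=> y; apply: continuous_comp; [exact: c1|exact: sqrt_continuous].
by [].
Qed.

Lemma Rintegral_slice_itv m (g : R -> R) : continuous g ->
  \int[mu]_y (sqrt_pow m (1 - y ^+ 2) * g y) =
  \int[mu]_(y in `[-1, 1]) (Num.sqrt (1 - y ^+ 2) ^+ m * g y).
Proof.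
move=> cg; pose s (y : R) := Num.sqrt (1 - y ^+ 2).
have csX : continuous (fun y => s y ^+ m).
  move=> y; apply: (@continuous_comp _ _ _ s (fun z => z ^+ m)); last exact: exprn_continuous.
  exact: continuous_sqrt_slice.
have mg : measurable_fun setT (fun y : RT => (s y ^+ m * g y)%:E).
  apply/measurable_EFinP; apply: measurable_funM; exact: continuous_measurable_fun.
rewrite [RHS]/Rintegral integral_itv_bndoo; last exact: measurable_funTS.
rewrite [in RHS]integral_mkcond; congr fine; apply: eq_integral => y _.
rewrite patchE /sqrt_pow subr_gt0 mem_setE /= in_itv/= -ltr_norml -sqr_lt1.
by case: ifPn => //; rewrite mul0r.
Qed.

(** The integrand is the derivative of P y * sqrt (1 - y ^+ 2) ^+ m.+2, which
    vanishes at both endpoints of the interval from -1 to 1. *)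
Lemma slice_parts (m : nat) (P P' : R -> R) :
  (forall y : R, is_derive y 1 P (P' y)) -> continuous P' ->
  \int[mu]_y (sqrt_pow m (1 - y ^+ 2) * (P' y * (1 - y ^+ 2) - m.+2%:R * (y * P y))) = 0.
Proof.
move=> dP cP'.
pose s (y : R) := Num.sqrt (1 - y ^+ 2).
pose g y := P' y * (1 - y ^+ 2) - m.+2%:R * (y * P y).
have cP (y : R) : {for y, continuous P} by apply: derivable_continuous; case: (dP y).
have cg : continuous g.
  move=> y; apply: cvgB.
    apply: cvgM; first exact: cP'.
    by apply: (@derivable_continuous _ (fun z => 1 - z ^+ 2)); exact: ex_derive.
  apply: cvgM; first exact: cvg_cst.
  by apply: cvgM => //; exact: cP.
have cs : continuous s by exact: continuous_sqrt_slice.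
have csX j : continuous (fun y => s y ^+ j).
  move=> y; apply: (@continuous_comp _ _ _ s (fun z => z ^+ j)); first exact: cs.
  exact: exprn_continuous.
have dF (y : R) : -1 < y < 1 -> is_derive y 1 (fun y => P y * s y ^+ m.+2) (s y ^+ m * g y).
  rewrite -ltr_norml -sqr_lt1 -subr_gt0 => y1.
  have s0 : 0 < s y by rewrite sqrtr_gt0.
  have ds : is_derive y 1 s ((2 * s y)^-1 * (- (2 * y))).
    have d2 : is_derive y 1 (fun z : R => 1 - z ^+ 2) (- (2 * y)).
      by apply: is_derive_eq; rewrite /GRing.scale/=; ring.
    exact: (@is_derive1_comp _ Num.sqrt _ y _ _ (is_derive1_sqrt y1) d2).
  have dsX := @is_deriveX _ _ s m.+2 y 1 _ ds.
  rewrite exprfctE in dsX.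
  have dPs := @is_deriveM _ _ P (fun y => s y ^+ m.+2) y 1 _ _ (dP y) dsX.
  apply: (@is_derive_eq _ _ _ _ _ _ _ _ dPs).
  have sn0 : s y != 0 by rewrite gt_eqF.
  rewrite /g (_ : 1 - y ^+ 2 = s y ^+ 2); last by rewrite sqr_sqrtr// ltW.
  rewrite /GRing.scale/=.
  move: (s y) sn0 (P y) (P' y) => a a0 b c; rewrite !exprS; by field; rewrite ?a0.
rewrite (Rintegral_slice_itv m cg) -/s.
rewrite /Rintegral (@continuous_FTC2 R (fun y => s y ^+ m * g y) (fun y => P y * s y ^+ m.+2))//.
- by rewrite /s sqrrN expr1n subrr sqrtr0 !expr0n/= !mulr0 subrr.
- by apply: continuous_subspaceT => y; apply: cvgM; [exact: csX|exact: cg].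
- split.
  + by move=> y; rewrite in_itv/= => /dF; case.
  + by apply: cvg_at_right_filter; apply: cvgM; [exact: cP|exact: csX].
  + by apply: cvg_at_left_filter; apply: cvgM; [exact: cP|exact: csX].
- by move=> y; rewrite in_itv/= derive1E => /dF; case.
Qed.

Lemma continuous_cosM (k : R) : continuous (fun y => cos (k * y)).
Proof. by move=> y; apply: derivable_continuous; exact: ex_derive. Qed.

Lemma integrable_slice_cos m (k : R) :
  mu.-integrable setT (EFin \o (fun y => sqrt_pow m (1 - y ^+ 2) * cos (k * y))).
Proof.
apply: integrable_slice_mul => [|y _]; [exact: continuous_cosM|exact: normr_cos_le1].
Qed.

Lemma integrable_slice_sin m (k : R) :
  mu.-integrable setT (EFin \o (fun y => sqrt_pow m (1 - y ^+ 2) * (y * sin (k * y)))).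
Proof.
apply: integrable_slice_mul => [y|y y1].
  by apply: derivable_continuous; exact: ex_derive.
by rewrite normrM mulr_ile1// ler_norml sin_geN1 sin_le1.
Qed.

(** Apply slice_parts to P y = sin (k * y). *)
Lemma slice_cos_sin m (k : R) : k * slice_cos m.+2 k = m.+2%:R * slice_sin m k.
Proof.
have dP (y : R) : is_derive y 1 (fun y => sin (k * y)) (k * cos (k * y)).
  by apply: is_derive_eq; rewrite /GRing.scale/=; ring.
have cP' : continuous (fun y => k * cos (k * y)).
  by move=> y; apply: derivable_continuous; exact: ex_derive.
apply/eqP; rewrite -subr_eq0; apply/eqP; rewrite -[RHS](slice_parts m dP cP').
have i1 := integrable_slice_cos m.+2 k; have i2 := integrable_slice_sin m k.
rewrite -(RintegralZl k measurableT i1) -(RintegralZl m.+2%:R measurableT i2).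
have i1' := integrableZl measurableT k i1; have i2' := integrableZl measurableT m.+2%:R i2.
rewrite -(RintegralB measurableT i1' i2').
by apply: eq_Rintegral => y _; rewrite -sqrt_pow_mulr; ring.
Qed.

(** Apply slice_parts to P y = y * cos (k * y). *)
Lemma slice_cos_rec m (k : R) :
  m.+3%:R * slice_cos m.+2 k - k * slice_sin m.+2 k = m.+2%:R * slice_cos m k.
Proof.
have dP (y : R) : is_derive y 1 (fun y => y * cos (k * y)) (cos (k * y) - k * (y * sin (k * y))).
  by apply: is_derive_eq; rewrite /GRing.scale/=; ring.
have cP' : continuous (fun y => cos (k * y) - k * (y * sin (k * y))).
  by move=> y; apply: derivable_continuous; exact: ex_derive.
apply/eqP; rewrite -subr_eq0; apply/eqP; rewrite -[RHS](slice_parts m dP cP').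
have i1 := integrable_slice_cos m.+2 k; have i2 := integrable_slice_sin m.+2 k.
have i3 := integrable_slice_cos m k.
rewrite -(RintegralZl m.+3%:R measurableT i1) -(RintegralZl k measurableT i2).
rewrite -(RintegralZl m.+2%:R measurableT i3).
have i1' := integrableZl measurableT m.+3%:R i1; have i2' := integrableZl measurableT k i2.
have i3' := integrableZl measurableT m.+2%:R i3.
rewrite -(RintegralB measurableT i1' i2').
rewrite -(RintegralB measurableT (integrableB measurableT i1' i2') i3').
apply: eq_Rintegral => y _.
by rewrite -sqrt_pow_mulr -(natr1 m.+2); ring.
Qed.

End slice_integrals.

(** * A uniform bound for a Bessel pair *)

Lemma le_of_derive_ge0 (R : realType) (f f' : R -> R) (a b : R) : a <= b ->
  (forall x, a < x < b -> is_derive x 1 f (f' x)) ->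
  (forall x, a < x < b -> 0 <= f' x) ->
  (forall x, a <= x <= b -> {for x, continuous f}) -> f a <= f b.
Proof.
rewrite le_eqVlt => /predU1P[-> //|ab] df f'0 cf.
have df1 (x : R) : x \in `]a, b[%R -> is_derive x 1 f (f' x) by rewrite in_itv/= => /df.
have cf1 : {within `[a, b], continuous f}.
  by apply: continuous_in_subspaceT => x; rewrite inE/= in_itv/= => /cf.
have [c] := MVT ab df1 cf1; rewrite in_itv/= => /f'0 c0 fE.
by rewrite -subr_ge0 fE mulr_ge0// subr_ge0 ltW.
Qed.

Lemma ge_of_derive_le0 (R : realType) (f f' : R -> R) (a b : R) : a <= b ->
  (forall x, a < x < b -> is_derive x 1 f (f' x)) ->
  (forall x, a < x < b -> f' x <= 0) ->
  (forall x, a <= x <= b -> {for x, continuous f}) -> f b <= f a.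
Proof.
move=> ab df f'0 cf; rewrite -lerN2.
apply: (@le_of_derive_ge0 _ (fun x => - f x) (fun x => - f' x) _ _ ab).
- by move=> x /df dfx; apply: is_deriveN.
- by move=> x /f'0; rewrite oppr_ge0.
- by move=> x /cf cfx; exact: cvgN.
Qed.

Lemma is_derive_expn (R : realType) (n : nat) (x : R) :
  is_derive x 1 (fun y => y ^+ n) (n%:R * x ^+ n.-1).
Proof.
have := @is_deriveX R R id n x 1 1 (is_derive_id _ _).
by rewrite exprfctE /GRing.scale/= mulr1.
Qed.

Lemma is_derive_sqrt_expn (R : realType) (n : nat) (x : R) : 0 < x ->
  is_derive x 1 (fun y => Num.sqrt y ^+ n) (n%:R / 2 / x * Num.sqrt x ^+ n).
Proof.
move=> x0; have ds := is_derive1_sqrt x0.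
have := @is_deriveX R R Num.sqrt n x 1 _ ds; rewrite exprfctE.
move/is_derive_eq; apply; rewrite /GRing.scale/=.
case: n => [|n]; first by rewrite !mul0r.
have s0 : Num.sqrt x != 0 by rewrite gt_eqF// sqrtr_gt0.
have xE : x = Num.sqrt x ^+ 2 by rewrite sqr_sqrtr// ltW.
move: (Num.sqrt x) s0 xE => s s0 -> /=; rewrite (exprS s n).
by field.
Qed.

(** Bernoulli's inequality for the exponent d / 8, raised to the power 8. In the
    induction step on d, with z = x / (1 + x), what remains is
    (1 + z / 8) ^+ 8 <= (1 - z)^-1, which follows from
    1 - z <= (1 - z / 8) ^+ 8. *)
Lemma bernoulli_eighth (R : realType) (d : nat) (x : R) : (8 <= d)%N -> 0 <= x ->
  (1 + d%:R / 8 * x) ^+ 8 <= (1 + x) ^+ d.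
Proof.
move=> d8 x0; rewrite -(subnK d8); elim: (d - 8)%N => [|j IH].
  by rewrite add0n divff// mul1r.
set m : R := (j + 8)%:R / 8 in IH *.
have m1 : 1 <= m by rewrite /m ler_pdivlMr// mul1r natrD lerDr.
rewrite addSn [leRHS]exprS.
have y0 : 0 < 1 + m * x by rewrite ltr_pwDl// mulr_ge0// (le_trans _ m1).
have -> : (j + 8).+1%:R / 8 = m + 8^-1 :> R by rewrite -natr1 mulrDl div1r.
move: m m1 y0 IH => m m1 y0 IH.
have -> : 1 + (m + 8^-1) * x = (1 + m * x) * (1 + (x / 8) / (1 + m * x)).
  by field; rewrite gt_eqF.
rewrite exprMn [leLHS]mulrC; apply: ler_pM => //.
- by rewrite exprn_ge0// addr_ge0// divr_ge0// ?divr_ge0// ltW.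
- by rewrite exprn_ge0// ltW.
have x1 : 0 < 1 + x by rewrite ltr_pwDl.
pose z := x / (1 + x).
have z0 : 0 <= z by rewrite divr_ge0// ltW.
have z1 : z < 1 by rewrite ltr_pdivrMr// mul1r ltrDr.
have zE : 1 + x = (1 - z)^-1 by rewrite /z; field; rewrite gt_eqF//= addrK oner_eq0.
apply: (@le_trans _ _ ((1 + z / 8) ^+ 8)).
  have q0 : 0 <= x / 8 / (1 + m * x) by rewrite !divr_ge0// ltW.
  have qz : x / 8 / (1 + m * x) <= z / 8.
    rewrite [leLHS]mulrAC ler_wpM2r// ler_wpM2l// lef_pV2 ?posrE//.
    by rewrite lerD2l ler_peMl.
  by rewrite lerXn2r ?nnegrE ?lerD2l// addr_ge0// divr_ge0.
rewrite zE -[leRHS]div1r ler_pdivlMr ?subr_gt0//.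
have b : 1 - z <= (1 - z / 8) ^+ 8.
  have : 0 <= z <= 1 by rewrite z0 ltW.
  move: (z) => y /andP[y0' y1]; nra.
apply: (le_trans (ler_wpM2l _ b)).
  by rewrite exprn_ge0// addr_ge0// divr_ge0.
have w1 : (z / 8) ^+ 2 <= 1.
  by move: z0 z1; move: (z) => y h0 h1; nra.
rewrite -exprMn (_ : (1 + z / 8) * (1 - z / 8) = 1 - (z / 8) ^+ 2); last by ring.
by apply: exprn_ile1; [rewrite subr_ge0|rewrite lerBlDr lerDl sqr_ge0].
Qed.

(** With y = d / 8 * (k ^+ 2 - 1), Bernoulli's inequality gives
    k ^+ d >= (1 + y) ^+ 4, and (1 + y) ^+ 2 >= 4 * y. *)
Lemma kappa_pow_ge (R : realType) (d : nat) (k : R) : (8 <= d)%N -> 1 <= k ->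
  (d%:R / 2) ^+ 2 * (k ^+ 2 - 1) ^+ 2 <= k ^+ d.
Proof.
move=> d8 k1.
pose y := d%:R / 8 * (k ^+ 2 - 1).
have x0 : 0 <= k ^+ 2 - 1 by rewrite subr_ge0 exprn_ege1.
have y0 : 0 <= y by rewrite mulr_ge0// divr_ge0.
have k0 : 0 <= k by exact: le_trans k1.
have h : (1 + y) ^+ 4 <= k ^+ d.
  rewrite -(@ler_pXn2r _ 2)// ?nnegrE ?exprn_ge0 ?addr_ge0//.
  have -> : (k ^+ d) ^+ 2 = (1 + (k ^+ 2 - 1)) ^+ d by rewrite subrKC -!exprM mulnC.
  by rewrite -exprM; exact: bernoulli_eighth.
apply: le_trans h.
have -> : (d%:R / 2) ^+ 2 * (k ^+ 2 - 1) ^+ 2 = 16 * y ^+ 2 by rewrite /y; field.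
rewrite -subr_ge0 (_ : _ - _ = (1 - y) ^+ 2 * ((1 + y) ^+ 2 + 4 * y)); last by ring.
by rewrite mulr_ge0 ?sqr_ge0// addr_ge0 ?sqr_ge0// mulr_ge0.
Qed.

(** The functions u and v stand for the normalised transforms of the unit sphere
    and of the unit ball in dimension d. The hypothesis decay is the Bessel
    inequality of ball_transform_decay, available as long as v decreases, and hQ
    is a lower bound for the volume of the unit ball. *)
Section bessel_pair.
Variables (R : realType) (d : nat) (T Q : R) (u v : R -> R).
Hypothesis d8 : (8 <= d)%N.
Hypothesis T0 : 0 < T.
Hypothesis du : forall x : R, is_derive x 1 u (- (x / d%:R * v x)).
Hypothesis dv : forall x : R, 0 < x -> is_derive x 1 v (d%:R / x * (u x - v x)).
Hypothesis cv : forall x : R, {for x, continuous v}.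
Hypotheses (u0 : u 0 = 1) (v0 : v 0 = 1).
Hypothesis decay : forall k : R, 0 < k -> 0 <= v k ->
  (forall x : R, 0 <= x < k -> v k <= v x) -> v k ^+ 2 * k ^+ d <= Q.
Local Notation nu := (d%:R / 2 : R).
Hypothesis hQ : Q <= 16 * nu * T ^+ 2 * nu ^+ d.

Let d_gt0 : 0 < d%:R :> R.
Proof. by rewrite ltr0n (leq_trans _ d8). Qed.

Let nu_ge4 : 4 <= nu.
Proof. by rewrite ler_pdivlMr// -natrM ler_nat. Qed.

Let cu (x : R) : {for x, continuous u}.
Proof. by apply: derivable_continuous; case: (du x). Qed.

Let cX n (x : R) : {for x, continuous (fun y : R => y ^+ n)}.
Proof. by apply: derivable_continuous; case: (is_derive_expn n x). Qed.

Let phi (x : R) := v x - 2 * u x.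

Let cphi (x : R) : {for x, continuous phi}.
Proof.
by apply: cvgB; [exact: cv|apply: cvgM; [exact: cvg_cst|exact: cu]].
Qed.

Section before_first_zero.
Variable k : R.
Hypothesis u_ge0 : forall x : R, 0 <= x <= k -> 0 <= u x.

(** x ^+ d * v has derivative d * x ^+ d.-1 * u. *)
Lemma pair_v_ge0 x : 0 <= x <= k -> 0 <= v x.
Proof.
move=> /andP[x0 xk]; have := x0; rewrite le_eqVlt => /predU1P[<-|x_gt0].
  by rewrite v0.
have h : 0 ^+ d * v 0 <= x ^+ d * v x.
  apply: (@le_of_derive_ge0 _ (fun y => y ^+ d * v y) (fun y => d%:R * y ^+ d.-1 * u y)) => //.
  - move=> y /andP[y0 yx]; have dX := is_derive_expn d y; have dvy := dv y0.
    apply: is_derive_eq; rewrite /GRing.scale/=.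
    have -> : y ^+ d = y * y ^+ d.-1 by rewrite -exprS prednK// (leq_trans _ d8).
    by field; rewrite gt_eqF.
  - move=> y /andP[y0 yx]; apply: mulr_ge0.
      by apply: mulr_ge0; [exact: ltW|rewrite exprn_ge0// ltW].
    by apply: u_ge0; rewrite ltW//= (le_trans (ltW yx)).
  - by move=> y _; apply: cvgM; [exact: cX|exact: cv].
move: h; rewrite v0 expr0n gtn_eqF ?(leq_trans _ d8)//= mul0r pmulr_rge0//.
by rewrite exprn_gt0.
Qed.

(** x ^+ d * (v - u) has derivative x ^+ d.+1 / d * v. *)
Lemma pair_v_ge_u (x : R) : 0 <= x <= k -> u x <= v x.
Proof.
move=> /andP[x0 xk]; have := x0; rewrite le_eqVlt => /predU1P[<-|x_gt0].
  by rewrite v0 u0.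
have h : 0 ^+ d * (v 0 - u 0) <= x ^+ d * (v x - u x).
  apply: (@le_of_derive_ge0 _ (fun y => y ^+ d * (v y - u y))
    (fun y => y ^+ d * (y / d%:R * v y))) => //.
  - move=> y /andP[y0 yx]; have dX := is_derive_expn d y; have dvy := dv y0; have duy := du y.
    apply: is_derive_eq; rewrite /GRing.scale/=.
    have -> : y ^+ d = y * y ^+ d.-1 by rewrite -exprS prednK// (leq_trans _ d8).
    by field; rewrite !gt_eqF.
  - move=> y /andP[y0 yx]; apply: mulr_ge0; first by rewrite exprn_ge0// ltW.
    apply: mulr_ge0; first by rewrite divr_ge0// ltW.
    by apply: pair_v_ge0; rewrite ltW//= (le_trans (ltW yx)).
  - by move=> y _; apply: cvgM; [exact: cX|apply: cvgB; [exact: cv|exact: cu]].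
move: h; rewrite v0 u0 subrr mulr0 pmulr_rge0 ?exprn_gt0//.
by rewrite subr_ge0.
Qed.

Lemma pair_v_nincr (x y : R) : 0 <= x -> x <= y -> y <= k -> v y <= v x.
Proof.
move=> x0 xy yk.
apply: (@ge_of_derive_le0 _ v (fun z => d%:R / z * (u z - v z))) => //.
- by move=> z /andP[xz zy]; apply: dv; exact: le_lt_trans xz.
- move=> z /andP[xz zy]; have z0 : 0 < z by exact: le_lt_trans xz.
  rewrite mulr_ge0_le0// ?divr_ge0 ?(ltW z0)// subr_le0.
  by apply: pair_v_ge_u; rewrite (ltW z0)/= (le_trans (ltW zy)).
Qed.

Lemma pair_decay (x : R) : 0 < x -> x <= k -> v x ^+ 2 * x ^+ d <= 16 * nu * T ^+ 2 * nu ^+ d.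
Proof.
move=> x0 xk; apply: le_trans hQ; apply: decay => //.
  by apply: pair_v_ge0; rewrite ltW.
by move=> y /andP[y0 yx]; apply: pair_v_nincr => //; exact: ltW.
Qed.

(** For x > nu, the decay of v beats the growth of the polynomial factor, because
    x ^+ d exceeds nu ^+ d * (nu * ((x / nu) ^+ 2 - 1)) ^+ 2 by kappa_pow_ge. *)
Lemma pair_drive (x : R) : 0 < x -> x <= k -> ((x / nu) ^+ 2 - 1) * v x <= 2 * T.
Proof.
move=> x0 xk; have nu0 : 0 < nu by rewrite (lt_le_trans _ nu_ge4).
have v_ge0 : 0 <= v x by apply: pair_v_ge0; rewrite ltW.
have T2 : 0 <= 2 * T by rewrite mulr_ge0// ltW.
have [xnu|nux] := leP (x / nu) 1.
  apply: le_trans T2; rewrite mulr_le0_ge0// subr_le0 exprn_ile1// divr_ge0// ltW//.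
set w := (x / nu) ^+ 2 - 1.
have w0 : 0 <= w by rewrite subr_ge0 exprn_ege1// ltW.
rewrite -(@ler_pXn2r _ 2)// ?nnegrE ?mulr_ge0//.
have xd0 : 0 < x ^+ d by rewrite exprn_gt0.
rewrite -(ler_pM2r xd0) exprMn -mulrA.
apply: (le_trans (ler_wpM2l (sqr_ge0 w) (pair_decay x0 xk))).
have K : nu ^+ 2 * w ^+ 2 * nu ^+ d <= x ^+ d.
  have := kappa_pow_ge d8 (ltW nux); rewrite -/w => h.
  by rewrite -[leRHS](mulfVK (expf_neq0 d (lt0r_neq0 nu0))) -expr_div_n ler_wpM2r// exprn_ge0// ltW.
have -> : w ^+ 2 * (16 * nu * T ^+ 2 * nu ^+ d) =
    (16 * T ^+ 2 / nu) * (nu ^+ 2 * w ^+ 2 * nu ^+ d) by field; rewrite gt_eqF.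
apply: (@le_trans _ _ ((16 * T ^+ 2 / nu) * x ^+ d)).
  rewrite ler_wpM2l//; apply: divr_ge0; last exact: ltW.
  by apply: mulr_ge0 => //; exact: sqr_ge0.
rewrite ler_wpM2r ?(ltW xd0)// ler_pdivrMr// exprMn.
have := sqr_ge0 T; move: (T ^+ 2) nu_ge4 => t; nra.
Qed.

(** The factor sqrt x ^+ d absorbs the damping term of phi' = - (nu / x) phi +
    (x / nu - nu / x) v, and pair_drive bounds the forcing term. *)
Lemma pair_phi_le : 0 <= k -> phi k <= 2 * T.
Proof.
move=> k_ge0; have nu0 : 0 < nu by rewrite (lt_le_trans _ nu_ge4).
move: k_ge0; rewrite le_eqVlt => /predU1P[<-|k0].
  by rewrite /phi v0 u0; move: T0 => h; lra.
have h : Num.sqrt k ^+ d * (phi k - 2 * T) <= Num.sqrt 0 ^+ d * (phi 0 - 2 * T).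
  apply: (@ge_of_derive_le0 _ (fun x => Num.sqrt x ^+ d * (phi x - 2 * T))
    (fun x => Num.sqrt x ^+ d * (nu / x) * (((x / nu) ^+ 2 - 1) * v x - 2 * T))).
  - exact: ltW.
  - move=> x /andP[x0 xk]; have dX := is_derive_sqrt_expn d x0.
    have dvx := dv x0; have dux := du x.
    rewrite /phi; apply: is_derive_eq; rewrite /GRing.scale/=.
    by field; rewrite !gt_eqF.
  - move=> x /andP[x0 xk]; rewrite mulr_ge0_le0//.
      by rewrite mulr_ge0 ?exprn_ge0 ?sqrtr_ge0// divr_ge0// ltW.
    by rewrite subr_le0; apply: pair_drive => //; exact: ltW.
  - move=> x _; apply: cvgM; last by apply: cvgB; [exact: cphi|exact: cvg_cst].
    by apply: (@continuous_comp _ _ _ Num.sqrt (fun y => y ^+ d)); [exact: sqrt_continuous|exact: cX].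
move: h; rewrite sqrtr0 expr0n gtn_eqF ?(leq_trans _ d8)//= mul0r pmulr_rle0 ?subr_le0//.
by rewrite exprn_gt0// sqrtr_gt0.
Qed.

End before_first_zero.

(** After a zero of u the energy u ^+ 2 + (x / d) ^+ 2 * v ^+ 2 decreases, and by
    the Cauchy-Schwarz inequality it controls phi. At the zero k1 the energy is
    (k1 / d) ^+ 2 * v k1 ^+ 2; it is bounded by pair_phi_le if k1 is at most of
    the order of nu, and by the decay of v otherwise. *)
Lemma pair_phi_after (k1 k : R) : 0 < k1 -> k1 <= k ->
  (forall x, 0 <= x <= k1 -> 0 <= u x) -> u k1 = 0 -> phi k <= 4 * T.
Proof.
move=> k10 k1k u_ge0 uk1; have nu0 : 0 < nu by rewrite (lt_le_trans _ nu_ge4).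
have k0 : 0 < k by exact: lt_le_trans k1k.
have T_ge0 := ltW T0.
pose E x := u x ^+ 2 + (x / d%:R) ^+ 2 * v x ^+ 2.
pose E' x := 2 * x / d%:R ^+ 2 * (1 - d%:R) * v x ^+ 2.
have dE (x : R) : 0 < x -> is_derive x 1 E (E' x).
  move=> x0; have dvx := dv x0; have dux := du x.
  rewrite /E /E'; apply: is_derive_eq; rewrite /GRing.scale/=.
  by field; rewrite !gt_eqF.
have EE : E k <= E k1.
  apply: (@ge_of_derive_le0 _ E E') => //.
  - by move=> x /andP[x1 _]; apply: dE; exact: lt_trans x1.
  - move=> x /andP[x1 _]; have x0 : 0 < x by exact: lt_trans x1.
    rewrite /E' mulr_le0_ge0 ?sqr_ge0// mulr_ge0_le0//.
      by apply: divr_ge0; [apply: mulr_ge0 => //; exact: ltW|exact: sqr_ge0].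
    by rewrite subr_le0 ler1n (leq_trans _ d8).
  - move=> x /andP[x1 _]; apply: derivable_continuous.
    by case: (dE x (lt_le_trans k10 x1)).
have k1k1 : 0 <= k1 <= k1 by rewrite lexx ltW.
have v1_ge0 := pair_v_ge0 u_ge0 k1k1.
have v1_le : v k1 <= 2 * T.
  by have := pair_phi_le u_ge0 (ltW k10); rewrite /phi uk1 mulr0 subr0.
(* Cauchy-Schwarz for phi k = d / k * (k / d * v k) - 2 * u k; the square left over
     is that of Lagrange's identity. *)
have cs : phi k ^+ 2 <= ((d%:R / k) ^+ 2 + 4) * E k.
  have -> : ((d%:R / k) ^+ 2 + 4) * E k =
     phi k ^+ 2 + (d%:R / k * u k + 2 * (k / d%:R) * v k) ^+ 2.
    by rewrite /E /phi; field; rewrite !gt_eqF.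
  by rewrite lerDl sqr_ge0.
set w := (k1 / nu) ^+ 2.
have cs1 : phi k ^+ 2 <= (1 + w) * v k1 ^+ 2.
  apply: (le_trans cs); apply: (@le_trans _ _ (((d%:R / k1) ^+ 2 + 4) * E k1)).
    apply: ler_pM => //.
    - by rewrite addr_ge0// sqr_ge0.
    - by apply: addr_ge0; [exact: sqr_ge0|apply: mulr_ge0; exact: sqr_ge0].
    - rewrite lerD2r lerXn2r ?nnegrE ?divr_ge0 ?(ltW k0) ?(ltW k10)//.
      by rewrite ler_wpM2l// lef_pV2.
  by rewrite /E uk1 le_eqVlt; apply/orP; left; apply/eqP; rewrite /w; field; rewrite !gt_eqF.
suff : (1 + w) * v k1 ^+ 2 <= (4 * T) ^+ 2.
  move=> h; apply: (le_trans (ler_norm _)).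
  rewrite -(@ler_pXn2r _ 2) ?nnegrE ?mulr_ge0//.
  by rewrite real_normK ?num_real//; exact: le_trans h.
(* For w <= 3 the bound v k1 <= 2 * T is enough; for w >= 3 the decay of v is,
   since then 1 + w <= (w - 1) ^+ 2. *)
have [w3|w3] := leP w 3.
  have : v k1 ^+ 2 <= (2 * T) ^+ 2 by rewrite lerXn2r ?nnegrE// mulr_ge0.
  have := sqr_ge0 (v k1); rewrite !exprMn.
  by move: (v k1 ^+ 2) (T ^+ 2) => a b; move: (w) w3 => y; nra.
have kd0 : 0 < k1 ^+ d by rewrite exprn_gt0.
rewrite -(ler_pM2r kd0) -mulrA.
have w0 : 0 <= 1 + w by rewrite addr_ge0// sqr_ge0.
apply: (le_trans (ler_wpM2l w0 (pair_decay u_ge0 k10 (lexx _)))).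
have kn : 1 <= k1 / nu.
  rewrite -(@ler_pXn2r _ 2) ?nnegrE ?divr_ge0 ?(ltW k10) ?(ltW nu0)//.
  by rewrite expr1n -/w; move: (w) w3 => y; lra.
have K : nu ^+ 2 * (w - 1) ^+ 2 * nu ^+ d <= k1 ^+ d.
  have := kappa_pow_ge d8 kn; rewrite -/w => h.
  by rewrite -[leRHS](mulfVK (expf_neq0 d (lt0r_neq0 nu0))) -expr_div_n ler_wpM2r// exprn_ge0// ltW.
have -> : (1 + w) * (16 * nu * T ^+ 2 * nu ^+ d) = (4 * T) ^+ 2 * ((1 + w) * nu * nu ^+ d) by ring.
rewrite ler_wpM2l ?sqr_ge0//; apply: le_trans K; rewrite ler_wpM2r ?exprn_ge0 ?(ltW nu0)//.
have h1 : 1 + w <= (w - 1) ^+ 2 by move: (w) w3 => y y3; nra.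
have nu1 : 1 <= nu by rewrite (le_trans _ nu_ge4)// ler1n.
rewrite mulrC expr2 -mulrA ler_wpM2l ?(ltW nu0)//.
by rewrite (le_trans h1)// ler_peMl// sqr_ge0.
Qed.

(** If u takes a negative value before k, the infimum of the set of such points
    is a zero of u before which u is nonnegative. *)
Lemma pair_phi_bound (k : R) : 0 <= k -> v k - 2 * u k <= 4 * T.
Proof.
move=> k_ge0.
have [h|/existsNP[x0 /not_implyP[/andP[x00 x0k] /negP]]] :=
  pselect (forall x, 0 <= x <= k -> 0 <= u x).
  by apply: (le_trans (pair_phi_le h k_ge0)); rewrite ler_wpM2r ?(ltW T0)// ler_nat.
rewrite -ltNge => ux0.
pose S := [set x | 0 <= x <= k /\ u x < 0].
have S0 : S x0 by split => //; rewrite x00.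
have hlb : lbound S 0 by move=> x [/andP[]].
have hS : has_inf S by split; [exists x0|exists 0].
pose k1 := inf S.
have k1_ge0 : 0 <= k1 by apply: lb_le_inf => //; exists x0.
have k1k : k1 <= k by apply: le_trans x0k; apply: ge_inf => //; exists 0.
have before x : 0 <= x -> x < k1 -> 0 <= u x.
  move=> x_ge0 xk1; rewrite leNgt; apply/negP => ux.
  have : k1 <= x.
    by apply: ge_inf; [exists 0|split => //; rewrite x_ge0 (le_trans (ltW xk1))].
  by rewrite leNgt xk1.
have uk1_le0 : u k1 <= 0.
  rewrite leNgt; apply/negP => uk1.
  have near_k1 := cvgr_gt _ (@cu k1) _ uk1.
  have [e /= e0 he] := (@nbhs_ballP _ _ _ _).1 (near_k1 _).
  have [y [/andP[y0 yk] uy] yk1] := inf_adherent e0 hS.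
  have := he y; rewrite /ball/=.
  have k1y : k1 <= y by apply: ge_inf; [exists 0|split => //; rewrite y0].
  rewrite distrC ger0_norm ?subr_ge0// ltrBlDl => /(_ yk1).
  by rewrite ltNge (ltW uy).
have k1_gt0 : 0 < k1.
  rewrite lt_neqAle k1_ge0 andbT; apply/eqP => k10.
  by move: uk1_le0; rewrite -k10 u0 leNgt ltr01.
have uk1_ge0 : 0 <= u k1.
  rewrite leNgt; apply/negP => uk1.
  have near_k1 := cvgr_lt _ (@cu k1) _ uk1.
  have [e /= e0 he] := (@nbhs_ballP _ _ _ _).1 (near_k1 _).
  pose y := Num.max 0 (k1 - e / 2).
  have yk1 : y < k1 by rewrite gt_max k1_gt0/= ltrBlDr ltrDl divr_gt0.
  have y0 : 0 <= y by rewrite le_max lexx.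
  have := he y; rewrite /ball/= ger0_norm ?subr_ge0 ?(ltW yk1)//.
  have ye : k1 - y < e.
    rewrite ltrBlDr -ltrBlDl; apply: (@lt_le_trans _ _ (k1 - e / 2)).
      by rewrite ltrD2l ltrN2 ltr_pdivrMr// mulr_natr mulr2n ltrDl.
    by rewrite le_max lexx orbT.
  by move=> /(_ ye); rewrite ltNge before.
apply: (@pair_phi_after k1) => //.
  move=> x /andP[x_ge0]; rewrite le_eqVlt => /predU1P[->//|]; exact: before.
by apply/eqP; rewrite eq_le uk1_le0.
Qed.

End bessel_pair.

(** * Volume of the unit ball *)

Section ball_volume.
Variable R : realType.
Local Notation mu := (@lebesgue_measure R).

Lemma slice_weight0 : slice_weight R 0 = 2.
Proof.
have c1 : continuous (cst 1 : R -> R) by move=> y; exact: cst_continuous.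
have := Rintegral_slice_itv 0 c1.
under eq_Rintegral do rewrite mulr1.
rewrite -/(slice_weight R 0) => ->.
under eq_Rintegral do rewrite expr0 mulr1.
rewrite Rintegral_cst//= lebesgue_measure_itv/= lte_fin.
by rewrite (_ : -1 < 1 :> R) ?(lt_trans (ltrN10 _))//= mul1r opprK.
Qed.

(** Half the area of the unit disc, computed with y = sin x. *)
Lemma slice_weight1 : slice_weight R 1 = pi / 2.
Proof.
have c1 : continuous (cst 1 : R -> R) by move=> y; exact: cst_continuous.
have := Rintegral_slice_itv 1 c1.
under eq_Rintegral do rewrite mulr1.
rewrite -/(slice_weight R 1) => ->.
under eq_Rintegral do rewrite expr1 mulr1.
pose h : R := pi / 2.
have h0 : 0 < h by rewrite divr_gt0 ?pi_gt0.
have sinh : sin h = 1 by exact: sin_pihalf.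
have sinNh : sin (- h) = -1 by rewrite sinN sinh.
have hh : - h < h by rewrite gtrN.
have dsin (x : R) : is_derive x 1 sin (cos x) by exact: is_derive_sin.
have dsinE : derive1 (@sin R) = @cos R.
  by apply/funext => x; rewrite derive1E; case: (dsin x).
rewrite /Rintegral -[X in `[X, 1%R]]sinNh -[X in `[_, X]]sinh.
rewrite (@integration_by_substitution_increasing R sin
  (fun x => Num.sqrt (1 - x ^+ 2)) (- h) h); last 7 first.
- exact: ltW.
- move=> x y xh yh xy; rewrite ltr_sin//.
- by rewrite dsinE => x _; exact: continuous_cos.
- by rewrite dsinE; apply/cvg_ex; exists (cos (- h)); apply: cvg_at_right_filter; exact: continuous_cos.
- by rewrite dsinE; apply/cvg_ex; exists (cos h); apply: cvg_at_left_filter; exact: continuous_cos.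
- split.
  + by move=> x _; case: (dsin x).
  + by apply: cvg_at_right_filter; exact: continuous_sin.
  + by apply: cvg_at_left_filter; exact: continuous_sin.
- by apply: continuous_subspaceT; exact: continuous_sqrt_slice.
rewrite dsinE.
transitivity (fine (\int[mu]_(x in `[(- h)%R, h]) (cos x ^+ 2)%:E)%E).
  congr fine; apply: eq_integral => x; rewrite inE/= in_itv/= => xh; congr EFin.
  rewrite mulrfctE /= -cos2sin2 sqrtr_sqr ger0_norm ?expr2//.
  exact: cos_ge0_pihalf.
pose F (x : R) := 2^-1 * (x + sin x * cos x).
have dF (x : R) : is_derive x 1 F (cos x ^+ 2).
  rewrite /F; apply: is_derive_eq; rewrite /GRing.scale/=.
  have := cos2Dsin2 x; move: (cos x) (sin x) => c s cs.
  rewrite [RHS](_ : _ = 2^-1 * (c ^+ 2 + s ^+ 2 + c ^+ 2 - s ^+ 2)); last by field.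
  by rewrite cs; ring.
rewrite (@continuous_FTC2 R (fun x => cos x ^+ 2) F)//.
- rewrite -EFinB /F sinN cosN /h cos_pihalf !mulr0 !addr0 /=.
  by move: (pi) => p; field.
- apply: continuous_subspaceT => x; apply: derivable_continuous; exact: ex_derive.
- have cF x : {for x, continuous F} by apply: derivable_continuous; case: (dF x).
  split.
  + by move=> x _; case: (dF x).
  + by apply: cvg_at_right_filter; exact: cF.
  + by apply: cvg_at_left_filter; exact: cF.
- by move=> x _; rewrite derive1E; case: (dF x).
Qed.

Lemma slice_weight_rec m : m.+3%:R * slice_weight R m.+2 = m.+2%:R * slice_weight R m.
Proof. by have := slice_cos_rec m (0 : R); rewrite !slice_cos0 mul0r subr0. Qed.

(** The telescoping in the proof of Wallis' product. *)
Lemma slice_weight_prod m : m.+2%:R * (slice_weight R m * slice_weight R m.+1) = 2 * pi.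
Proof.
elim: m => [|m IH]; first by rewrite slice_weight0 slice_weight1; move: (pi) => p; field.
rewrite -IH [RHS](_ : _ = slice_weight R m.+1 * (m.+2%:R * slice_weight R m)); last by ring.
by rewrite -slice_weight_rec; ring.
Qed.

Lemma ball_coef0 : ball_coef R 0 = 1.
Proof. by rewrite /ball_coef big_ord0. Qed.

Lemma ball_coefSS n : ball_coef R n.+2 = ball_coef R n * (2 * pi / n.+2%:R).
Proof.
rewrite !ball_coefS -(slice_weight_prod n).
have : n.+2%:R != 0 :> R by rewrite pnatr_eq0.
by move: (n.+2%:R) => x x0; field.
Qed.

(** The difference q vanishes at 0 and its derivative 1 - (1 - 2 * x) * expR (2 * x)
    is nonnegative since 1 - 2 * x <= expR (- (2 * x)). *)
Lemma expR2_le (z : R) : 0 <= z -> expR (2 * z) * (1 - z) <= 1 + z.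
Proof.
move=> z0; pose q (x : R) := 1 + x - expR (2 * x) * (1 - x).
have dq (x : R) : is_derive x 1 q (1 - (1 - 2 * x) * expR (2 * x)).
  by rewrite /q; apply: is_derive_eq; rewrite /GRing.scale/=; ring.
have : q 0 <= q z.
  apply: (@le_of_derive_ge0 _ q (fun x => 1 - (1 - 2 * x) * expR (2 * x))) => //.
  - move=> x _; rewrite subr_ge0 -[leRHS](expRxMexpNx_1 (2 * x)) mulrC ler_wpM2l ?expR_ge0//.
    exact: expR_ge1Dx.
  - by move=> x _; apply: derivable_continuous; case: (dq x).
by rewrite /q mulr0 expR0 subr0 addr0 mulr1 subrr subr_ge0.
Qed.

(** From expR (- 1 / 8) >= 1 - 1 / 8, that is expR (1 / 8) <= 8 / 7. *)
Lemma expR1_lt : expR 1 < 73 / 25 :> R.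
Proof.
have e8 : expR (8^-1) <= 8 / 7 :> R.
  have h : 1 - 8^-1 <= expR (- 8^-1) :> R by exact: expR_ge1Dx.
  rewrite -(invrK (8 / 7)) -(invrK (expR _)) -expRN lef_pV2 ?posrE ?expR_gt0//.
  by apply: le_trans h; lra.
have -> : 1 = 8%:R * 8^-1 :> R by field.
rewrite expRM_natl; apply: (@le_lt_trans _ _ ((8 / 7) ^+ 8)).
  by rewrite lerXn2r ?nnegrE ?expR_ge0.
by lra.
Qed.

(** A bound of Stirling type, by induction in steps of two dimensions: the step
    from n.+1 to n.+3 amounts to expR 2 <= ((n + 3) / (n + 1)) ^+ n.+2, which is
    expR2_le at z = 1 / (n + 2). The constant 8 leaves room for crude numerics in
    dimensions 1 and 2. *)
Lemma ball_coef_lower d : (0 < d)%N ->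
  (2 * pi * expR 1) ^+ d <= 8 * d%:R ^+ d.+1 * ball_coef R d ^+ 2.
Proof.
have e3 := expR1_lt; have e0 : 0 < expR 1 :> R by exact: expR_gt0.
have p4 : pi < 4 :> R by have := @pihalf_lt2 R; rewrite ltr_pdivrMr// -natrM.
have p0 := pi_gt0 R.
suff H n : ((2 * pi * expR 1) ^+ n.+1 <= 8 * n.+1%:R ^+ n.+2 * ball_coef R n.+1 ^+ 2) /\
  ((2 * pi * expR 1) ^+ n.+2 <= 8 * n.+2%:R ^+ n.+3 * ball_coef R n.+2 ^+ 2).
  by case: d => // d _; exact: (H d).1.
elim: n => [|n [IH1 IH2]].
  split.
    rewrite expr1 expr1n ball_coefS ball_coef0 mul1r mulr1 slice_weight0.
    by move: (pi) (expR 1) p0 p4 e0 e3 => p e; nra.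
  rewrite ball_coefSS ball_coef0 mul1r.
  have -> : 8 * 2 ^+ 3 * (2 * pi / 2) ^+ 2 = 4 * (4 * pi) ^+ 2 :> R by move: (pi) => p; field.
  rewrite [leRHS](_ : _ = (2 * pi * 4) ^+ 2); last by move: (pi) => p; ring.
  have pp : 0 <= 2 * pi :> R by apply: mulr_ge0 => //; exact: ltW.
  have a0 : 0 <= 2 * pi * expR 1 :> R by apply: mulr_ge0 => //; exact: ltW.
  have b0 : 0 <= 2 * pi * 4 :> R by exact: mulr_ge0.
  rewrite lerXn2r ?nnegrE// ler_wpM2l//.
  by move: (expR 1) e3 => e; lra.
split => //.
have n1 : 0 < n.+1%:R :> R by rewrite ltr0n.
have n3 : 0 < n.+3%:R :> R by rewrite ltr0n.
have key : expR 1 ^+ 2 * n.+1%:R ^+ n.+2 <= n.+3%:R ^+ n.+2 :> R.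
  have e2 : expR 1 ^+ 2 = expR (2 * n.+2%:R^-1) ^+ n.+2 :> R.
    by rewrite -[RHS]expRM_natr -mulrA mulVf ?pnatr_eq0// mulr1 -[LHS]expRM_natr mul1r.
  have q0 : 0 <= expR (2 * n.+2%:R^-1) * n.+1%:R :> R by rewrite mulr_ge0// expR_ge0.
  rewrite e2 -exprMn lerXn2r ?nnegrE//.
  have n2 : 0 < n.+2%:R :> R by rewrite ltr0n.
  have n2N : n.+2%:R != 0 :> R by rewrite gt_eqF.
  have E1 : n.+1%:R = n.+2%:R * (1 - n.+2%:R^-1) :> R.
    by rewrite mulrBr mulr1 divff// -(natr1 n.+1) addrK.
  have E3 : n.+3%:R = n.+2%:R * (1 + n.+2%:R^-1) :> R.
    by rewrite mulrDr mulr1 divff// natr1.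
  rewrite E1 E3 mulrCA ler_pM2l//; apply: expR2_le.
  by rewrite invr_ge0 ltW.
rewrite ball_coefSS 2!exprS mulrA.
have -> : 8 * n.+3%:R ^+ n.+4 * (ball_coef R n.+1 * (2 * pi / n.+3%:R)) ^+ 2 =
    (2 * pi) ^+ 2 * (8 * n.+3%:R ^+ n.+2 * ball_coef R n.+1 ^+ 2) :> R.
  by rewrite 2!exprS; move: (pi) => p; field; rewrite gt_eqF.
rewrite (_ : _ * _ * _ = (2 * pi) ^+ 2 * (expR 1 ^+ 2 * (2 * pi * expR 1) ^+ n.+1)); last by ring.
rewrite ler_wpM2l ?sqr_ge0//.
apply: (le_trans (ler_wpM2l (sqr_ge0 _) IH1)).
rewrite [leLHS](_ : _ = (8 * ball_coef R n.+1 ^+ 2) * (expR 1 ^+ 2 * n.+1%:R ^+ n.+2)); last by ring.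
rewrite [leRHS](_ : _ = (8 * ball_coef R n.+1 ^+ 2) * n.+3%:R ^+ n.+2); last by ring.
by rewrite ler_wpM2l// mulr_ge0// sqr_ge0.
Qed.

End ball_volume.

(** * Radial transforms of balls and the choice of dual function *)

Section ball_radius.
Variable R : realType.

Lemma slice_weight_gt0 m : 0 < slice_weight R m.
Proof.
rewrite lt_neqAle slice_weight_ge0 andbT eq_sym; apply/eqP => w0.
have := slice_weight_prod R m; rewrite w0 mul0r mulr0 => /esym/eqP.
by rewrite mulf_eq0 pnatr_eq0/= gt_eqF// pi_gt0.
Qed.

Lemma ball_coef_gt0 n : 0 < ball_coef R n.
Proof. by apply: prodr_gt0 => i _; exact: slice_weight_gt0. Qed.

Lemma slice_sinE m (k : R) : slice_sin m k = k / m.+2%:R * slice_cos m.+2 k.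
Proof.
have m0 : m.+2%:R != 0 :> R by rewrite pnatr_eq0.
by apply: (mulfI m0); rewrite -slice_cos_sin mulrA mulrCA divff// mulr1.
Qed.

(** The transforms of the unit ball and of the unit sphere in dimension m.+3,
    normalised to 1 at the origin: the projection of the sphere to a line has
    density proportional to sqrt (1 - y ^+ 2) ^+ m, that of the ball to
    sqrt (1 - y ^+ 2) ^+ m.+2. *)
Definition ball_wave m (k : R) : R := slice_cos m.+2 k / slice_weight R m.+2.
Definition sphere_wave m (k : R) : R := slice_cos m k / slice_weight R m.

Lemma ball_wave0 m : ball_wave m 0 = 1.
Proof. by rewrite /ball_wave slice_cos0 divff// gt_eqF// slice_weight_gt0. Qed.

Lemma sphere_wave0 m : sphere_wave m 0 = 1.
Proof. by rewrite /sphere_wave slice_cos0 divff// gt_eqF// slice_weight_gt0. Qed.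

Lemma is_derive_sphere_wave m (k : R) :
  is_derive k 1 (sphere_wave m) (- (k / m.+3%:R * ball_wave m k)).
Proof.
have dC := derivable_slice_cos m k.
rewrite /sphere_wave; apply: is_derive_eq; rewrite /GRing.scale/= slice_sinE /ball_wave.
have := slice_weight_rec R m.
have := slice_weight_gt0 m; have := slice_weight_gt0 m.+2.
have : 0 < m.+2%:R :> R by rewrite ltr0n. have : 0 < m.+3%:R :> R by rewrite ltr0n.
move: (slice_weight R m) (slice_weight R m.+2) (m.+2%:R : R) (m.+3%:R : R) (slice_cos m.+2 k).
move=> a b p q c q0 p0 b0 a0 E.
have -> : a = q * b / p by rewrite E mulrAC divff ?mul1r// gt_eqF.
by field; rewrite !gt_eqF.
Qed.

Lemma is_derive_ball_wave m (k : R) : 0 < k ->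
  is_derive k 1 (ball_wave m) (m.+3%:R / k * (sphere_wave m k - ball_wave m k)).
Proof.
move=> k0; have dC := derivable_slice_cos m.+2 k.
rewrite {1}/ball_wave; apply: is_derive_eq; rewrite /GRing.scale/= /ball_wave /sphere_wave.
have := slice_weight_rec R m; have := slice_cos_rec m k.
have := slice_weight_gt0 m; have := slice_weight_gt0 m.+2.
have : 0 < m.+2%:R :> R by rewrite ltr0n. have : 0 < m.+3%:R :> R by rewrite ltr0n.
move: (slice_weight R m) (slice_weight R m.+2) (m.+2%:R : R) (m.+3%:R : R)
  (slice_cos m.+2 k) (slice_sin m.+2 k) (slice_cos m k).
move=> a b p q c s c' q0 p0 b0 a0 Es E.
have -> : c' = (q * c - k * s) / p by rewrite Es mulrAC divff ?mul1r// gt_eqF.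
have -> : a = q * b / p by rewrite E mulrAC divff ?mul1r// gt_eqF.
by field; rewrite !gt_eqF.
Qed.

Lemma continuous_ball_wave m (k : R) : {for k, continuous (ball_wave m)}.
Proof.
apply: cvgM; last exact: cvg_cst.
by apply: derivable_continuous; case: (derivable_slice_cos m.+2 k).
Qed.

Lemma cosft_ball_wave m (s : R) (t : 'rV[R]_m.+3) : 0 < s ->
  cosft (ball_ind s) t = ball_coef R m.+3 * s ^+ m.+3 * ball_wave m (s * (2 * pi * norm2 t)).
Proof.
move=> s0; rewrite cosft_ball_ind// /ball_wave (ball_coefS _ m.+2).
have := slice_weight_gt0 m.+2.
move: (slice_weight R m.+2) (slice_cos _ _) (ball_coef R m.+2) (s ^+ m.+3) => a b c e a0.
by field; rewrite gt_eqF.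
Qed.

(** (2 / e) to the power d / 2. *)
Definition lp_rate (d : nat) : R := Num.sqrt ((2 / expR 1) ^+ d).

Lemma lp_rate_gt0 d : 0 < lp_rate d.
Proof. by rewrite sqrtr_gt0 exprn_gt0// divr_gt0// expR_gt0. Qed.

Lemma lp_rate_sqr d : lp_rate d ^+ 2 = (2 / expR 1) ^+ d.
Proof. by rewrite sqr_sqrtr// exprn_ge0// divr_ge0// expR_ge0. Qed.

(** The two waves form a Bessel pair. The ball of frequencies on which the
    transform is at least its value at x has radius x / (2 * pi). *)
Lemma wave_gap_le m (k : R) : (8 <= m.+3)%N -> 0 <= k ->
  ball_wave m k - 2 * sphere_wave m k <= 4 * lp_rate m.+3.
Proof.
move=> d8; set B := ball_coef R m.+3; have B0 : 0 < B by exact: ball_coef_gt0.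
have pi2 : 0 < 2 * pi :> R by apply: mulr_gt0 => //; exact: pi_gt0.
apply: (@pair_phi_bound R m.+3 (lp_rate m.+3) ((2 * pi) ^+ m.+3 / B ^+ 2)) => //.
- exact: lp_rate_gt0.
- exact: is_derive_sphere_wave.
- exact: is_derive_ball_wave.
- exact: continuous_ball_wave.
- exact: sphere_wave0.
- exact: ball_wave0.
- move=> x x0 vx vmono.
  have r0 : 0 < x / (2 * pi) by exact: divr_gt0.
  have c0 : 0 <= B * ball_wave m x by rewrite mulr_ge0// ltW.
  have := @ball_transform_decay R m.+2 (B * ball_wave m x) (x / (2 * pi)) r0 c0.
  rewrite -/B => h.
  have : (B * ball_wave m x) ^+ 2 * (B * (x / (2 * pi)) ^+ m.+3) <= B.
    apply: h => t tx; rewrite (cosft_ball_wave _ ltr01) expr1n mulr1 mul1r ler_pM2l//.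
    apply: vmono; rewrite mulr_ge0 ?norm2_ge0 ?(ltW pi2)//=.
    by rewrite mulrC -ltr_pdivlMr.
  have -> : (B * ball_wave m x) ^+ 2 * (B * (x / (2 * pi)) ^+ m.+3) =
      (B ^+ 2 * ball_wave m x ^+ 2 * (x / (2 * pi)) ^+ m.+3) * B.
    by rewrite exprMn (mulrC B) mulrA.
  move=> H; have {H} : B ^+ 2 * ball_wave m x ^+ 2 * (x / (2 * pi)) ^+ m.+3 <= 1.
    by rewrite -(ler_pM2r B0) mul1r.
  rewrite [(x / _) ^+ _]expr_div_n => H.
  rewrite ler_pdivlMr ?exprn_gt0//.
  have q0 : 0 < (2 * pi) ^+ m.+3 :> R by rewrite exprn_gt0.
  rewrite -[leRHS]mul1r -ler_pdivrMr//; apply: le_trans H.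
  rewrite le_eqVlt; apply/orP; left; apply/eqP.
  move: ((2 * pi) ^+ m.+3)^-1 (x ^+ m.+3 : R) (ball_wave m x) => a b c.
  by move: B {B0 c0 h} => B; ring.
- have e0 : 0 < expR 1 :> R by exact: expR_gt0.
  have q0 : 0 < expR 1 ^+ m.+3 :> R by rewrite exprn_gt0.
  have L := @ball_coef_lower R m.+3 isT; rewrite -/B in L.
  rewrite lp_rate_sqr ler_pdivrMr ?exprn_gt0// -(ler_pM2r q0) -exprMn.
  apply: (le_trans L); rewrite le_eqVlt; apply/orP; left; apply/eqP.
  rewrite !expr_div_n (exprS m.+3%:R m.+3).
  have q1 : expR 1 ^+ m.+3 != 0 :> R by rewrite gt_eqF.
  have q2 : 2 ^+ m.+3 != 0 :> R by rewrite expf_neq0.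
  move: (expR 1 ^+ m.+3) q1 (2 ^+ m.+3) q2 (m.+3%:R) (m.+3%:R ^+ m.+3) => a a0 b b0 c d.
  by field; rewrite ?a0 ?b0.
Qed.

(** Write nu for m.+3 / 2. The function z ^ nu * ball_wave z is the Bessel function
    of order nu up to a constant; adding 4 * T * z ^ nu, with T the rate, makes
    it nondecreasing, since the sum has derivative
    nu * z ^ (nu - 1) * (4 * T - (ball_wave z - 2 * sphere_wave z)). *)
Lemma ball_wave_increment m (x y : R) : (8 <= m.+3)%N -> 0 < x -> x <= y ->
  Num.sqrt x ^+ m.+3 * ball_wave m x - Num.sqrt y ^+ m.+3 * ball_wave m y <=
  4 * lp_rate m.+3 * (Num.sqrt y ^+ m.+3 - Num.sqrt x ^+ m.+3).
Proof.
move=> d8 x0 xy; set T := lp_rate m.+3.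
pose h (z : R) := Num.sqrt z ^+ m.+3 * (ball_wave m z + 4 * T).
pose h' (z : R) := m.+3%:R / 2 / z * Num.sqrt z ^+ m.+3 *
  (4 * T - (ball_wave m z - 2 * sphere_wave m z)).
have dh (z : R) : 0 < z -> is_derive z 1 h (h' z).
  move=> z0; have dX := is_derive_sqrt_expn m.+3 z0.
  have dvz := is_derive_ball_wave m z0.
  rewrite /h; apply: is_derive_eq; rewrite /GRing.scale/= /h'.
  move: (Num.sqrt z ^+ m.+3) (ball_wave m z) (sphere_wave m z) (m.+3%:R) => a b c e.
  by field; rewrite gt_eqF.
have : h x <= h y.
  apply: (@le_of_derive_ge0 _ h h') => //.
  - by move=> z /andP[xz _]; apply: dh; exact: lt_trans xz.
  - move=> z /andP[xz _]; have z0 := lt_trans x0 xz.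
    apply: mulr_ge0; last by rewrite subr_ge0; apply: wave_gap_le => //; exact: ltW.
    apply: mulr_ge0; last by rewrite exprn_ge0// sqrtr_ge0.
    by rewrite !divr_ge0// ltW.
  - move=> z /andP[xz _]; apply: derivable_continuous.
    by case: (dh z (lt_le_trans x0 xz)).
by rewrite /h; lra.
Qed.

End ball_radius.

(** * Lower bounds for the radius *)

Section radius_bound.
Variables (R : realType) (n : nat).
Local Notation la := (lebesgue_rV R n.+1).
Local Notation V := 'rV[R]_n.+1.

Lemma LP_feasibleP (f : V -> R) (r : R) : LP_feasible f r ->
  [/\ 0 < r, continuous f, la.-integrable setT (EFin \o f), 0 < f 0 /\ \int[la]_x f x = f 0 &
      (forall x, r <= norm2 x -> f x <= 0) /\ (forall t, 0 <= cosft f t)].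
Proof.
move=> [r0 cf intf [fE f0] [fneg ft]].
have ReE t : complex.Re (fourier f t) = cosft f t.
  by apply: eq_Rintegral => x _ /=; rewrite mul0r subr0 cosN.
split => //; split => //.
  have := congr1 (@complex.Re R) fE; rewrite ReE /= => ->.
  by apply: eq_Rintegral => x _; rewrite dotpC dotp0l mulr0 cos0 mulr1.
by move=> t; have := ft t; rewrite -ReE lecE => /andP[].
Qed.

Lemma integrable_ball_mul (f : V -> R) (s : R) : la.-integrable setT (EFin \o f) ->
  la.-integrable setT (EFin \o (fun x => f x * ball_ind s x)).
Proof.
move=> intf; apply: (integrable_mul_bounded intf (@measurable_ball_ind R n.+1 s)).
exact: normr_ball_ind_le1.
Qed.

(** Integrating f over a larger and larger domain beyond the ball of radius r can
    only lower the integral. *)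
Lemma feasible_ball_integral (f : V -> R) (r s : R) : 0 < r -> r <= s ->
  la.-integrable setT (EFin \o f) -> (forall x, r <= norm2 x -> f x <= 0) ->
  \int[la]_x f x <= \int[la]_x (f x * ball_ind s x) <= \int[la]_x (f x * ball_ind r x).
Proof.
move=> r0 rs intf fneg; have s0 : 0 < s by exact: lt_le_trans rs.
have i1 := integrable_ball_mul s intf; have i2 := integrable_ball_mul r intf.
apply/andP; split; apply: le_Rintegral => // x _.
  rewrite (ball_indE _ (ltW s0)); case: ifPn => [_|]; first by rewrite mulr1.
  by rewrite -leNgt mulr0 => sx; apply: fneg; exact: le_trans sx.
rewrite (ball_indE _ (ltW s0)) (ball_indE _ (ltW r0)).
case: ifPn => [xs|xs]; case: ifPn => [xr|xr] //; rewrite ?mulr0 ?mulr1.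
  by apply: fneg; rewrite leNgt.
by move: xs; rewrite (lt_le_trans xr rs).
Qed.

(** Duality for the single ball of radius r, whose transform is at most its
    volume. *)
Lemma radius_bound_trivial (f : V -> R) (r : R) : LP_feasible f r ->
  1 <= ball_coef R n.+1 * r ^+ n.+1.
Proof.
move=> /LP_feasibleP[r0 cf intf [f0 fE] [fneg ft]].
have /andP[h1 h2] := feasible_ball_integral r0 (lexx r) intf fneg.
have M0 : 0 <= ball_coef R n.+1 * r ^+ n.+1.
  by rewrite mulr_ge0 ?ball_coef_ge0// exprn_ge0// ltW.
have := @ball_duality R n f r r 1 0 _ r0 r0 M0 cf intf f0 fneg ft.
rewrite mul1r mul0r subr0 => H.
rewrite -(ler_pM2r f0) mul1r -[leLHS]fE; apply: (le_trans h1); apply: H => t.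
rewrite mul1r mul0r subr0 (le_trans (ler_norm _))//.
apply: (le_trans (cosft_le t (integrable_ball_ind n r0))).
rewrite -(Rintegral_ball_ind n r0) le_eqVlt; apply/orP; left; apply/eqP.
by apply: eq_Rintegral => x _; rewrite ger0_norm// ball_ind_ge0.
Qed.

End radius_bound.

Section sharp_radius_bound.
Variables (R : realType) (m : nat).
Local Notation la := (lebesgue_rV R m.+3).
Local Notation V := 'rV[R]_m.+3.

(** With g x = x ^ nu, nu half the dimension, and G the integral of f over a ball
    as a function of its radius, duality for the coefficients (g r)^-1 and
    (g s)^-1 bounds G r / g r - G s / g s. As f 0 <= G s <= G r, this quantity is
    at least ((g r)^-1 - (g s)^-1) * f 0. Dividing by g s - g r gives a bound on
    g r * g s, and s tends to r. *)
Lemma radius_bound_sharp (f : V -> R) (r : R) : (8 <= m.+3)%N -> LP_feasible f r ->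
  1 <= 4 * lp_rate R m.+3 * ball_coef R m.+3 * r ^+ m.+3.
Proof.
move=> d8 /LP_feasibleP[r0 cf intf [f0 fE] [fneg ft]].
set T := lp_rate R m.+3; set B := ball_coef R m.+3.
have T0 : 0 < T by exact: lp_rate_gt0.
have B0 : 0 < B by exact: ball_coef_gt0.
pose g (x : R) := Num.sqrt x ^+ m.+3.
have g_gt0 x : 0 < x -> 0 < g x by move=> x0; rewrite exprn_gt0// sqrtr_gt0.
have gM x y : 0 < x -> g (x * y) = g x * g y by move=> x0; rewrite /g sqrtrM ?exprMn// ltW.
have gg x : 0 < x -> g x * g x = x ^+ m.+3 by move=> x0; rewrite -exprMn -expr2 sqr_sqrtr// ltW.
have key s : r < s -> 1 <= 4 * T * B * (g r * g s).
  move=> rs; have s0 : 0 < s by exact: lt_trans rs.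
  have gr := g_gt0 r r0; have gs := g_gt0 s s0.
  have grs : g r < g s by rewrite ltr_pXn2r ?nnegrE ?sqrtr_ge0// ltr_sqrt.
  have M0 : 0 <= B * (4 * T * (g s - g r)).
    by rewrite !mulr_ge0 ?(ltW B0) ?(ltW T0)// subr_ge0 ltW.
  have H := @ball_duality R m.+2 f r s (g r)^-1 (g s)^-1 _ r0 s0 M0 cf intf f0 fneg ft.
  have {}H : (g r)^-1 * (\int[la]_x (f x * ball_ind r x)) -
      (g s)^-1 * (\int[la]_x (f x * ball_ind s x)) <= B * (4 * T * (g s - g r)) * f 0.
    apply: H => t; rewrite !cosft_ball_wave// -/B -!gg//.
    rewrite [leLHS](_ : _ = B * (g r * ball_wave m (r * (2 * pi * norm2 t)) -
        g s * ball_wave m (s * (2 * pi * norm2 t)))); last first.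
      by field; rewrite !gt_eqF.
    rewrite ler_pM2l//; have := norm2_ge0 t; rewrite le_eqVlt => /predU1P[<-|t0].
      rewrite !mulr0 ball_wave0 !mulr1 (@le_trans _ _ 0)//; first by rewrite subr_le0 ltW.
      by rewrite !mulr_ge0 ?(ltW T0)// subr_ge0 ltW.
    have k0 : 0 < 2 * pi * norm2 t by rewrite !mulr_gt0// pi_gt0.
    move: (2 * pi * norm2 t) k0 => k k0; have gk := g_gt0 k k0.
    have := @ball_wave_increment R m (r * k) (s * k) d8 (mulr_gt0 r0 k0).
    rewrite ler_pM2r// => /(_ (ltW rs)); rewrite -/(g (r * k)) -/(g (s * k)) !gM// -/T => h.
    rewrite -(ler_pM2r gk); apply: le_trans (le_trans h _);
      rewrite le_eqVlt; apply/orP; left; apply/eqP; ring.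
  have /andP[h1 h2] := feasible_ball_integral r0 (ltW rs) intf fneg.
  have K : ((g r)^-1 - (g s)^-1) * f 0 <= B * (4 * T * (g s - g r)) * f 0.
    apply: le_trans H; rewrite -fE mulrBl.
    have a0 : 0 < (g r)^-1 by rewrite invr_gt0.
    have b0 : 0 < (g s)^-1 by rewrite invr_gt0.
    have ba : (g s)^-1 <= (g r)^-1 by rewrite lef_pV2 ?posrE// ltW.
    move: h1 h2 a0 b0 ba; move: (g r)^-1 (g s)^-1 (\int[la]_x f x).
    move: (\int[la]_x (f x * ball_ind r x)) (\int[la]_x (f x * ball_ind s x)).
    by move=> p q a b c h1 h2 a0 b0 ba; nra.
  move: K; rewrite ler_pM2r// => K.
  have gd : 0 < g s - g r by rewrite subr_gt0.
  rewrite -(ler_pM2r gd) mul1r.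
  have grs0 : 0 < g r * g s by exact: mulr_gt0.
  move: K; rewrite -(ler_pM2r grs0) => K; apply: le_trans (le_trans K _);
    rewrite le_eqVlt; apply/orP; left; apply/eqP; last by ring.
  by field; rewrite !gt_eqF.
have cg : {for r, continuous (fun s => 4 * T * B * (g r * g s))}.
  apply: cvgM; first exact: cvg_cst.
  apply: cvgM; first exact: cvg_cst.
  by apply: derivable_continuous; case: (is_derive_sqrt_expn m.+3 r0).
have : (fun s => 4 * T * B * (g r * g s)) @ r^'+ --> 4 * T * B * (g r * g r).
  exact: (cvg_at_right_filter cg).
rewrite gg// => /cvgr_to_ge; apply.
by near=> s; apply: key; near: s; exact: nbhs_right_gt.
Unshelve. all: by end_near. Qed.

End sharp_radius_bound.

(** * The bound for the linear program *)

Section conclusion.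
Variable R : realType.

(** ball_coef is the volume of the open unit ball, which lies in the closed one. *)
Lemma ball_coef_le_vol n : ((ball_coef R n.+1)%:E <= vol_unit_ball R n.+1)%E.
Proof.
have := integral_ball_ind n (@ltr01 R); rewrite expr1n mulr1 => <-.
have mn : measurable_fun setT (fun x : 'rV[R]_n.+1 => norm2 x : measurableTypeR R).
  by apply: measurable_fun_sqrt; exact: (@measurable_fun_dotp R n.+1 _ _ id id).
have mS : measurable [set x : 'rV[R]_n.+1 | norm2 x <= 1].
  rewrite (_ : mkset _ = (fun x : 'rV[R]_n.+1 => norm2 x) @^-1` `]-oo, 1]%classic); last first.
    by apply/seteqP; split => x /=; rewrite in_itv.
  by rewrite -[X in measurable X]setTI; apply: mn.
rewrite /vol_unit_ball -[X in lebesgue_rV _ _ X]setIT -integral_indic//.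
apply: ge0_le_integral => //.
- by move=> x _; rewrite lee_fin ball_ind_ge0.
- by apply/measurable_EFinP; exact: measurable_ball_ind.
- by apply/measurable_EFinP; exact: measurable_indic.
move=> x _; rewrite lee_fin (ball_indE _ ler01) indicE; case: ifPn => [x1|_] //.
by rewrite mem_set//=; exact: ltW.
Qed.

Lemma powR_half_sqr (a : R) (d : nat) : 0 < a -> (a `^ (d%:R / 2)) ^+ 2 = a ^+ d.
Proof.
move=> a0; rewrite -powR_mulrn ?powR_ge0// -powRrM.
by rewrite divfK// powR_mulrn// ltW.
Qed.

(** In dimension at most 7 the trivial bound is enough, as (e / 2) ^+ 7 <= 16.
    From dimension 8 on, the sharp bound is the claim, because
    (e / 8) * (2 / e) * 2 ^+ 2 = 1. *)
Lemma lp_value_le n (f : 'rV[R]_n.+1 -> R) (r : R) : LP_feasible f r ->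
  4^-1 * (expR 1 / 8) `^ (n.+1%:R / 2) <= ball_coef R n.+1 * (r / 2) ^+ n.+1.
Proof.
move=> fe; set S := _ `^ _.
have e0 : 0 < expR 1 :> R by exact: expR_gt0.
have S2 : S ^+ 2 = (expR 1 / 8) ^+ n.+1 by apply: powR_half_sqr; rewrite divr_gt0.
have S0 : 0 <= S by exact: powR_ge0.
have p2 : 0 < 2 ^+ n.+1 :> R by rewrite exprn_gt0.
rewrite expr_div_n mulrA ler_pdivlMr//.
have [d8|d8] := leqP 8 n.+1; last first.
  apply: le_trans (radius_bound_trivial fe).
  rewrite -mulrA ler_pdivrMl// mulr1 -(@ler_pXn2r _ 2) ?nnegrE ?mulr_ge0 ?(ltW p2)//.
  rewrite exprMn S2 -exprM mulnC exprM -exprMn.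
  have -> : expR 1 / 8 * 2 ^+ 2 = expR 1 / 2 :> R by field.
  have e1 : expR 1 / 2 <= 73 / 50 :> R by have := expR1_lt R; move: (expR 1) => e; lra.
  apply: (@le_trans _ _ ((73 / 50) ^+ n.+1)).
    by rewrite lerXn2r ?nnegrE ?divr_ge0 ?(ltW e0).
  (* The exponent is at most 7, and 1.46 ^+ 7 < 16. *)
  apply: (@le_trans _ _ ((73 / 50) ^+ 7)); last by lra.
  by rewrite ler_weXn2l//; lra.
case: n => [|[|m]] // in f fe S S2 S0 p2 d8 *.
have B := radius_bound_sharp d8 fe.
have T0 := lp_rate_gt0 R m.+3; have T2 := lp_rate_sqr R m.+3.
have ST : S * lp_rate R m.+3 * 2 ^+ m.+3 = 1.
  have P0 : 0 <= S * lp_rate R m.+3 * 2 ^+ m.+3.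
    by apply: mulr_ge0; [apply: mulr_ge0 => //; exact: ltW | exact: ltW].
  apply/eqP; rewrite -(pexpr_eq1 (isT : 0 < 2)%N P0) exprMn (exprMn 2 S) S2 T2; apply/eqP.
  rewrite -exprMn -exprM mulnC exprM -exprMn.
  have -> : expR 1 / 8 * (2 / expR 1) * 2 ^+ 2 = 1 :> R by field; rewrite gt_eqF.
  by rewrite expr1n.
rewrite -(ler_pM2r T0); apply: (@le_trans _ _ 4^-1).
  by rewrite (mulrAC (4^-1 * S)) -(mulrA 4^-1 S) -(mulrA 4^-1 (S * _)) ST mulr1.
by rewrite -[leLHS]mulr1 ler_pdivrMl// (le_trans B)// le_eqVlt; apply/orP; left; apply/eqP; ring.
Qed.

End conclusion.

Theorem mainTheorem3 (R : realType) (d : nat) (hd : (1 <= d)%N) :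
  ((4^-1 * (expR 1 / 8) `^ (d%:R / 2))%:E <= Delta_LP R d)%E.
Proof.
case: d hd => // n _; apply: le_ereal_inf_tmp => _ [r [f fe] <-].
have r0 : 0 < r by case: fe.
have p0 : (0 <= ((r / 2) ^+ n.+1)%:E)%E.
  by rewrite lee_fin exprn_ge0// divr_ge0// ltW.
apply: le_trans (lee_wpmul2r p0 (ball_coef_le_vol R n)).
by rewrite -EFinM lee_fin; exact: lp_value_le fe.
Qed.
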